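(* Let $d_{w,1}$ be a Lorentz sequence space (with $p=1$) and let $T\in L(d_{w,1})$. Then $T$ is $d_{w,1}$-strictly singular if and only if $T$ is Dunford–Pettis.
   Context: Let $w=(w_n)$ be a real sequence with $w_1=1$, $w_n\downarrow 0$ and $\sum_n w_n=\infty$. The Lorentz sequence space $d_{w,1}$ is the Banach space of all $x=(x_n)\in c_0$ with $\|x\|=\sum_{n}w_n x^*_n<\infty$, where $(x^*_n)$ is the non-increasing rearrangement of $(|x_n|)$. An operator $T\in L(d_{w,1})$ is $d_{w,1}$-strictly singular if for every closed subspace $Z$ isomorphic to $d_{w,1}$, $T|_Z$ is not an isomorphism. $T$ is Dunford–Pettis if $x_n\to 0$ weakly implies $\|Tx_n\|\to 0$. *)

(* Defs.v *)
From Stdlib Require Import Reals List.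
From Coquelicot Require Import Coquelicot.
Open Scope R_scope.

Definition weight (w : nat -> R) : Prop :=
  w 0%nat = 1 /\
  (forall n, w (S n) <= w n) /\
  is_lim_seq w 0 /\
  is_lim_seq (sum_n w) p_infty.

Definition few_above (x : nat -> R) (n : nat) (t : R) : Prop :=
  exists l : list nat, (length l <= n)%nat /\
    (forall k, t < Rabs (x k) -> In k l).

(* Non-increasing rearrangement of (|x_k|), indexed from 0:
   x*_n = inf { t >= 0 : #{k : |x_k| > t} <= n }. *)
Definition xstar (x : nat -> R) (n : nat) : R :=
  real (Glb_Rbar (fun t => 0 <= t /\ few_above x n t)).

Definition in_d (w : nat -> R) (x : nat -> R) : Prop :=
  is_lim_seq x 0 /\ ex_series (fun n => w n * xstar x n).

Definition dnorm (w : nat -> R) (x : nat -> R) : R :=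
  Series (fun n => w n * xstar x n).

Definition vadd (x y : nat -> R) : nat -> R := fun k => x k + y k.
Definition vscal (a : R) (x : nat -> R) : nat -> R := fun k => a * x k.
Definition vsub (x y : nat -> R) : nat -> R := fun k => x k - y k.
Definition vzero : nat -> R := fun _ => 0.

Definition bounded_op (w : nat -> R) (T : (nat -> R) -> (nat -> R)) : Prop :=
  (forall x, in_d w x -> in_d w (T x)) /\
  (forall x y, in_d w x -> in_d w y -> T (vadd x y) = vadd (T x) (T y)) /\
  (forall a x, in_d w x -> T (vscal a x) = vscal a (T x)) /\
  (exists C, forall x, in_d w x -> dnorm w (T x) <= C * dnorm w x).

Definition bounded_functional (w : nat -> R) (f : (nat -> R) -> R) : Prop :=
  (forall x y, in_d w x -> in_d w y -> f (vadd x y) = f x + f y) /\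
  (forall a x, in_d w x -> f (vscal a x) = a * f x) /\
  (exists C, forall x, in_d w x -> Rabs (f x) <= C * dnorm w x).

Definition weakly_null (w : nat -> R) (xs : nat -> nat -> R) : Prop :=
  forall f, bounded_functional w f -> is_lim_seq (fun n => f (xs n)) 0.

Definition dunford_pettis (w : nat -> R) (T : (nat -> R) -> (nat -> R)) : Prop :=
  forall xs : nat -> nat -> R,
    (forall n, in_d w (xs n)) -> weakly_null w xs ->
    is_lim_seq (fun n => dnorm w (T (xs n))) 0.

Definition closed_subspace (w : nat -> R) (Z : (nat -> R) -> Prop) : Prop :=
  (forall z, Z z -> in_d w z) /\
  Z vzero /\
  (forall x y, Z x -> Z y -> Z (vadd x y)) /\
  (forall a x, Z x -> Z (vscal a x)) /\
  (forall (zs : nat -> nat -> R) x, (forall n, Z (zs n)) -> in_d w x ->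
     is_lim_seq (fun n => dnorm w (vsub (zs n) x)) 0 -> Z x).

Definition iso_to_d (w : nat -> R) (Z : (nat -> R) -> Prop) : Prop :=
  exists (S : (nat -> R) -> (nat -> R)) (c C : R),
    0 < c /\
    (forall x, in_d w x -> Z (S x)) /\
    (forall z, Z z -> exists x, in_d w x /\ S x = z) /\
    (forall x y, in_d w x -> in_d w y -> S (vadd x y) = vadd (S x) (S y)) /\
    (forall a x, in_d w x -> S (vscal a x) = vscal a (S x)) /\
    (forall x, in_d w x -> c * dnorm w x <= dnorm w (S x) <= C * dnorm w x).

Definition iso_on (w : nat -> R) (T : (nat -> R) -> (nat -> R))
    (Z : (nat -> R) -> Prop) : Prop :=
  exists c, 0 < c /\ forall z, Z z -> c * dnorm w z <= dnorm w (T z).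

Definition d_strictly_singular (w : nat -> R) (T : (nat -> R) -> (nat -> R)) : Prop :=
  forall Z, closed_subspace w Z -> iso_to_d w Z -> ~ iso_on w T Z.

(* Main.v *)
(* The norm of [x] is the supremum of [sum_i w_i |x_(p_i)|] over finite injective
   sequences [p].  For a weakly null sequence [x_n] these sums are uniformly small
   once the weights are shifted: for every [eps] there is [N] with
   [sum_i w_(N+i) |x_n(p_i)| <= eps] for all large [n] and all [p] (gliding hump).
   Applied to [T e_n], this shows that [T e_n] either tends to 0 in norm or has
   coordinates bounded away from 0 along a subsequence; in the latter case [T] is
   bounded below on the span of a further subsequence of [e_n], which is isometric
   to the whole space.  If [T e_n] tends to 0, the same fact applied to a weakly null
   [x_n] splits it into a part of small norm and a part with boundedly many
   coordinates, on which [T] is small.  Conversely [e_n] is weakly null because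
   [(w_0 + ... + w_(m-1)) / m] tends to 0, so a Dunford-Pettis operator is bounded
   below on no copy of the space. *)
Require Import Defs.
From Stdlib Require Import Reals List FinFun Lra Lia Classical ClassicalEpsilon FunctionalExtensionality.
From Coquelicot Require Import Coquelicot.
Open Scope R_scope.

(** The unit vectors are weakly null and have norm 1, so weak convergence cannot make the full sums
    small. It can only do so after the first [N] weights are discarded, since a few large
    coordinates then carry little weight. Conversely, restoring those weights costs at most [N]
    times the largest coordinate, so small coordinates together with small shifted sums give a small
    norm. The hump functional is built on one principle: signs on distinct coordinates, multiplied
    by [w 0], [w 1], ... in order, define a functional of norm at most 1. Sums over injective lists
    replace rearrangements because they can be compared entry by entry, which makes the triangle
    inequality immediate. *)

(** Dependent choice with the whole past visible: the greedy enumeration, the hump blocks and the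
    almost diagonal extraction must each respect all earlier picks. *)
Lemma history_choice (A : Type) (P : list A -> A -> Prop) :
  (forall h, exists a, P h a) ->
  exists s : nat -> A, forall k, P (map s (seq 0 k)) (s k).
Proof.
  intros H.
  assert (H' : forall h, {a | P h a})
    by (intros h; apply constructive_indefinite_description, H).
  set (F h := proj1_sig (H' h)).
  set (hist := fix hist k := match k with O => nil | S k => hist k ++ F (hist k) :: nil end).
  exists (fun k => F (hist k)).
  assert (E : forall k, map (fun k => F (hist k)) (seq 0 k) = hist k).
  { induction k; [reflexivity|].
    rewrite seq_S, map_app, IHk. reflexivity. }
  intros k. rewrite E. apply (proj2_sig (H' (hist k))).
Qed.

(** * Weighted sums along finite lists *)

(** The offset [N] lets the remainder of a list be a sum of the same kind, with later weights. The
    entry type is arbitrary so that lists of coordinates with coefficients are covered too. *)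
Fixpoint psum {A : Type} (w : nat -> R) (N : nat) (g : A -> R) (l : list A) : R :=
  match l with
  | nil => 0
  | a :: l => w N * g a + psum w (S N) g l
  end.

Definition lsum (f : nat -> R) (l : list nat) : R := psum (fun _ => 1) 0 f l.

Definition wsum (w : nat -> R) (N : nat) (x : nat -> R) (p : list nat) : R :=
  psum w N (fun k => Rabs (x k)) p.

Lemma psum_app (A : Type) w N (g : A -> R) l l' :
  psum w N g (l ++ l') = psum w N g l + psum w (N + length l) g l'.
Proof.
  revert N; induction l as [|a l IH]; intros N; simpl.
  - rewrite Nat.add_0_r; lra.
  - rewrite IH, <- Nat.add_succ_comm; lra.
Qed.

Lemma psum_le (A : Type) w N (g h : A -> R) l :
  (forall n, 0 <= w n) -> (forall a, In a l -> g a <= h a) ->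
  psum w N g l <= psum w N h l.
Proof.
  intros Hw; revert N; induction l as [|a l IH]; intros N H; simpl; [lra|].
  apply Rplus_le_compat.
  - apply Rmult_le_compat_l; [apply Hw | apply H; now left].
  - apply IH; intros b Hb; apply H; now right.
Qed.

Lemma psum_zero (A : Type) w N (l : list A) : psum w N (fun _ => 0) l = 0.
Proof. revert N; induction l as [|a l IH]; intros N; simpl; [|rewrite IH]; lra. Qed.

Lemma psum_nonneg (A : Type) w N (g : A -> R) l :
  (forall n, 0 <= w n) -> (forall a, In a l -> 0 <= g a) -> 0 <= psum w N g l.
Proof.
  intros Hw H. rewrite <- (psum_zero A w N l). now apply psum_le.
Qed.

Lemma psum_plus (A : Type) w N (g h : A -> R) l :
  psum w N (fun a => g a + h a) l = psum w N g l + psum w N h l.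
Proof. revert N; induction l as [|a l IH]; intros N; simpl; [|rewrite IH]; lra. Qed.

Lemma psum_scal (A : Type) w N c (g : A -> R) l :
  psum w N (fun a => c * g a) l = c * psum w N g l.
Proof. revert N; induction l as [|a l IH]; intros N; simpl; [|rewrite IH]; lra. Qed.

Lemma psum_ext (A : Type) w N (g h : A -> R) l :
  (forall a, In a l -> g a = h a) -> psum w N g l = psum w N h l.
Proof.
  revert N; induction l as [|a l IH]; intros N H; simpl; [reflexivity|].
  rewrite (H a (or_introl eq_refl)), IH; [reflexivity|].
  intros b Hb; apply H; now right.
Qed.

Lemma psum_map (A B : Type) w N (f : A -> B) (g : B -> R) l :
  psum w N g (map f l) = psum w N (fun a => g (f a)) l.
Proof. revert N; induction l as [|a l IH]; intros N; simpl; [|rewrite IH]; lra. Qed.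

Lemma psum_abs (A : Type) w N (g : A -> R) l :
  (forall n, 0 <= w n) -> Rabs (psum w N g l) <= psum w N (fun a => Rabs (g a)) l.
Proof.
  intros Hw; revert N; induction l as [|a l IH]; intros N; simpl.
  - rewrite Rabs_R0; lra.
  - eapply Rle_trans; [apply Rabs_triang|].
    rewrite Rabs_mult, (Rabs_pos_eq (w N)) by apply Hw.
    specialize (IH (S N)); lra.
Qed.

Lemma weight_antitone w : weight w -> forall n m, (n <= m)%nat -> w m <= w n.
Proof.
  intros (_ & Hd & _) n m H; induction H; [lra|].
  specialize (Hd m); lra.
Qed.

Lemma weight_nonneg w : weight w -> forall n, 0 <= w n.
Proof.
  intros Hw n. destruct Hw as (_ & Hd & Hl & _).
  exact (is_lim_seq_decr_compare w 0 Hl Hd n).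
Qed.

Lemma weight_le_1 w : weight w -> forall n, w n <= 1.
Proof.
  intros Hw n. destruct (Hw) as (H1 & _). rewrite <- H1.
  apply weight_antitone; [assumption|lia].
Qed.

Lemma psum_shift (A : Type) w N M (g : A -> R) l :
  weight w -> (N <= M)%nat -> (forall a, In a l -> 0 <= g a) ->
  psum w M g l <= psum w N g l.
Proof.
  intros Hw; revert N M; induction l as [|a l IH]; intros N M H Hg; simpl; [lra|].
  apply Rplus_le_compat.
  - apply Rmult_le_compat_r; [apply Hg; now left | now apply weight_antitone].
  - apply IH; [lia|]. intros b Hb; apply Hg; now right.
Qed.

Lemma lsum_cons f a l : lsum f (a :: l) = f a + lsum f l.
Proof.
  assert (H : forall n m, psum (fun _ => 1) n f l = psum (fun _ => 1) m f l).
  { induction l as [|b l IH]; intros n m; simpl; [reflexivity|].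
    now rewrite (IH (S n) (S m)). }
  unfold lsum; simpl. rewrite (H 1%nat 0%nat); lra.
Qed.

Lemma lsum_app f l l' : lsum f (l ++ l') = lsum f l + lsum f l'.
Proof.
  induction l as [|a l IH]; simpl.
  - unfold lsum at 2; simpl; lra.
  - rewrite !lsum_cons, IH; lra.
Qed.

Lemma lsum_nonneg f l : (forall a, In a l -> 0 <= f a) -> 0 <= lsum f l.
Proof. intros H; apply psum_nonneg; [intros; lra | assumption]. Qed.

Lemma lsum_le f g l : (forall a, In a l -> f a <= g a) -> lsum f l <= lsum g l.
Proof. intros H; apply psum_le; [intros; lra | assumption]. Qed.

Lemma lsum_incl f l l' :
  (forall a, 0 <= f a) -> NoDup l -> incl l l' -> lsum f l <= lsum f l'.
Proof.
  intros Hf; revert l'; induction l as [|a l IH]; intros l' Hn Hi.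
  - apply lsum_nonneg; auto.
  - inversion Hn as [|? ? Ha Hl]; subst.
    destruct (in_split a l') as (l1 & l2 & ->); [apply Hi; now left|].
    rewrite lsum_app, !lsum_cons.
    assert (lsum f l <= lsum f (l1 ++ l2)).
    { apply IH; [assumption|]. intros b Hb.
      assert (In b (l1 ++ a :: l2)) by (apply Hi; now right).
      rewrite in_app_iff in *; simpl in *. intuition congruence. }
    rewrite lsum_app in H; lra.
Qed.

Lemma psum_le_lsum w N (g : nat -> R) l :
  weight w -> (forall a, 0 <= g a) -> psum w N g l <= lsum g l.
Proof.
  intros Hw Hg; revert N; induction l as [|a l IH]; intros N; [simpl; unfold lsum; simpl; lra|].
  rewrite lsum_cons; simpl. specialize (IH (S N)).
  assert (w N * g a <= 1 * g a)
    by (apply Rmult_le_compat_r; [apply Hg | now apply weight_le_1]).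
  lra.
Qed.

(* Deleting entries moves the remaining ones to larger weights. *)
Lemma psum_filter w N (g : nat -> R) (P : nat -> bool) l :
  weight w -> (forall a, 0 <= g a) ->
  psum w N g l <= psum w N g (filter P l) + lsum g (filter (fun a => negb (P a)) l).
Proof.
  intros Hw Hg; revert N; induction l as [|a l IH]; intros N.
  - simpl; unfold lsum; simpl; lra.
  - simpl. destruct (P a); simpl.
    + specialize (IH (S N)); lra.
    + rewrite lsum_cons.
      assert (w N * g a <= 1 * g a)
        by (apply Rmult_le_compat_r; [apply Hg | now apply weight_le_1]).
      specialize (IH (S N)).
      assert (psum w (S N) g (filter P l) <= psum w N g (filter P l))
        by (apply psum_shift; auto).
      lra.
Qed.

Lemma wsum_nonneg w N x p : weight w -> 0 <= wsum w N x p.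
Proof.
  intros Hw; apply psum_nonneg; [now apply weight_nonneg|].
  intros; apply Rabs_pos.
Qed.

Lemma wsum_shift w N M x p : weight w -> (N <= M)%nat -> wsum w M x p <= wsum w N x p.
Proof. intros Hw H; apply psum_shift; auto. intros; apply Rabs_pos. Qed.

(** * Greedy enumeration and the decreasing rearrangement *)

Lemma exists_argmax (f : nat -> R) l : l <> nil ->
  exists a, In a l /\ forall b, In b l -> f b <= f a.
Proof.
  induction l as [|a l IH]; [congruence|]. intros _.
  destruct l as [|b l].
  - exists a; split; [now left|]. intros c [<-|[]]; lra.
  - destruct IH as (c & Hc & Hm); [discriminate|].
    destruct (Rle_dec (f a) (f c)) as [H|H].
    + exists c; split; [now right|]. intros d [<-|Hd]; auto.
    + exists a; split; [now left|]. intros d [<-|Hd]; [lra|].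
      specialize (Hm d Hd); lra.
Qed.

Lemma exists_not_in (l : list nat) : exists m, forall k, In k l -> (k < m)%nat.
Proof.
  exists (S (list_max l)). intros k Hk.
  assert (H := proj1 (list_max_le l (list_max l)) (Nat.le_refl _)).
  rewrite Forall_forall in H. specialize (H k Hk); lia.
Qed.

Lemma lim0_iff (x : nat -> R) :
  is_lim_seq x 0 <-> forall eps, 0 < eps -> exists N, forall n, (N <= n)%nat -> Rabs (x n) <= eps.
Proof.
  split.
  - intros H eps He. apply is_lim_seq_spec in H.
    destruct (H (mkposreal eps He)) as [N HN]. exists N; intros n Hn.
    specialize (HN n Hn); simpl in HN. rewrite Rminus_0_r in HN; lra.
  - intros H. apply is_lim_seq_spec. intros [eps He].
    destruct (H (eps / 2)) as [N HN]; [lra|]. exists N; intros n Hn; simpl.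
    specialize (HN n Hn). rewrite Rminus_0_r; lra.
Qed.

(** Ties may be broken in any way. [s] need not be surjective: if a null sequence [x] has infinite
    support, its zeros are never listed. *)
Definition greedy (x : nat -> R) (s : nat -> nat) : Prop :=
  forall m, ~ In (s m) (map s (seq 0 m)) /\
    forall k, ~ In k (map s (seq 0 m)) -> Rabs (x k) <= Rabs (x (s m)).

Lemma greedy_exists (x : nat -> R) : is_lim_seq x 0 -> exists s, greedy x s.
Proof.
  intros Hx. apply (history_choice nat (fun h a => ~ In a h /\
    forall k, ~ In k h -> Rabs (x k) <= Rabs (x a))).
  intros h.
  destruct (classic (exists k, ~ In k h /\ 0 < Rabs (x k))) as [(k1 & Hk1 & Hp)|Hn].
  - destruct (proj1 (lim0_iff x) Hx (Rabs (x k1)) Hp) as [N HN].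
    (* From [N] on no entry exceeds that at [k1], so a maximum over this finite range is a maximum
       over everything outside [h]. *)
    set (l := filter (fun k => if in_dec Nat.eq_dec k h then false else true)
                (seq 0 (N + S k1))).
    assert (Hl : forall k, In k l <-> (k < N + S k1)%nat /\ ~ In k h).
    { intros k; unfold l; rewrite filter_In, in_seq.
      destruct (in_dec Nat.eq_dec k h); intuition (try lia; try congruence). }
    assert (Hk1l : In k1 l) by (apply Hl; split; [lia|assumption]).
    destruct (exists_argmax (fun k => Rabs (x k)) l) as (a & Ha & Hm).
    { intros E; rewrite E in Hk1l; destruct Hk1l. }
    exists a; split; [now apply Hl|]. intros k Hk.
    destruct (Nat.le_gt_cases (N + S k1) k) as [H|H].
    + apply Rle_trans with (Rabs (x k1)); [apply HN; lia | now apply (Hm k1)].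
    + apply Hm, Hl; split; assumption.
  (* All entries outside [h] vanish, so any fresh index is maximal. *)
  - destruct (exists_not_in h) as [m Hm]. exists m; split.
    + intros H; specialize (Hm m H); lia.
    + intros k Hk. apply Rle_trans with 0; [|apply Rabs_pos].
      apply Rnot_lt_le; intros H; apply Hn; exists k; auto.
Qed.

Lemma greedy_NoDup x s : greedy x s -> forall m, NoDup (map s (seq 0 m)).
Proof.
  intros Hg; induction m; [constructor|].
  rewrite seq_S, map_app; simpl.
  apply NoDup_app; [assumption | repeat constructor; simpl; tauto|].
  intros a Ha [<-|[]]. now apply (Hg m).
Qed.

(** [s m] was still available at stage [i], where [s i] was preferred. *)
Lemma greedy_antitone x s : greedy x s ->
  forall m i, (i <= m)%nat -> Rabs (x (s m)) <= Rabs (x (s i)).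
Proof.
  intros Hg m i Hi. apply (Hg i). intros H.
  apply (proj1 (Hg m)). apply in_map_iff in H as (j & Hj & Hs).
  rewrite in_seq in Hs. apply in_map_iff; exists j; split; [assumption|].
  apply in_seq; lia.
Qed.

(** Below the level [Rabs (x (s m))] there are [m + 1] greedy indices to cover, too many for a list
    of length [m]; at that level the first [m] greedy indices suffice. *)
Lemma xstar_greedy x s : greedy x s -> forall m, xstar x m = Rabs (x (s m)).
Proof.
  intros Hg m. unfold xstar.
  rewrite (is_glb_Rbar_unique _ (Finite (Rabs (x (s m))))); [reflexivity|]. split.
  - intros t [Ht (l & Hl & Hin)]. simpl.
    apply Rnot_lt_le; intros Hlt.
    assert (H : incl (map s (seq 0 (S m))) l).
    { intros k Hk. apply in_map_iff in Hk as (i & <- & Hi). apply in_seq in Hi.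
      apply Hin. eapply Rlt_le_trans; [exact Hlt|].
      apply greedy_antitone; [assumption|lia]. }
    apply NoDup_incl_length in H; [|now apply (greedy_NoDup x)].
    rewrite length_map, length_seq in H; lia.
  - intros b Hb. apply Hb. split; [apply Rabs_pos|].
    exists (map s (seq 0 m)). rewrite length_map, length_seq. split; [lia|].
    intros k Hk. apply NNPP; intros Hn. apply (Hg m) in Hn; lra.
Qed.

(** A list of [n + 1] distinct indices contains some [q] outside the first [n] greedy picks, and its
    entry is at most the next greedy one. Removing [q] lowers the length by one. *)
Lemma lsum_greedy x s : greedy x s -> forall p, NoDup p ->
  lsum (fun k => Rabs (x k)) p <= lsum (fun k => Rabs (x k)) (map s (seq 0 (length p))).
Proof.
  intros Hg.
  assert (H : forall n p, length p = n -> NoDup p ->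
    lsum (fun k => Rabs (x k)) p <= lsum (fun k => Rabs (x k)) (map s (seq 0 n))).
  { induction n as [|n IH]; intros p Hp Hn.
    - destruct p; [simpl; lra | discriminate].
    - assert (Hq : exists q, In q p /\ ~ In q (map s (seq 0 n))).
      { apply NNPP; intros Hc.
        assert (Hi : incl p (map s (seq 0 n)))
          by (intros q Hq; apply NNPP; intros Hq'; apply Hc; exists q; auto).
        apply NoDup_incl_length in Hi; [|assumption].
        rewrite length_map, length_seq in Hi; lia. }
      destruct Hq as (q & Hq & Hq').
      destruct (in_split q p Hq) as (l1 & l2 & ->).
      rewrite length_app in Hp; simpl in Hp.
      specialize (IH (l1 ++ l2)). rewrite length_app in IH.
      apply NoDup_remove_1 in Hn.
      specialize (IH ltac:(lia) Hn).
      rewrite seq_S, map_app, !lsum_app, lsum_cons in *; simpl.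
      rewrite lsum_cons. apply (Hg n) in Hq'. unfold lsum at 4; simpl.
      lra. }
  intros p Hp; now apply H.
Qed.

(* Abel summation: the partial sums along [p] are dominated by those along the
   greedy enumeration, and the weights decrease. *)
Lemma wsum_greedy w x s : weight w -> greedy x s -> forall p, NoDup p ->
  wsum w 0 x p <= wsum w 0 x (map s (seq 0 (length p))).
Proof.
  intros Hw Hg.
  set (A := lsum (fun k => Rabs (x k))).
  (* Strengthened for the induction: the lead of the greedy partial sum, priced at the next weight,
     is still available. The lead is nonnegative, so passing to a smaller weight only lowers the
     left side. *)
  assert (H : forall p, NoDup p ->
    w (length p) * (A (map s (seq 0 (length p))) - A p) <=
    wsum w 0 x (map s (seq 0 (length p))) - wsum w 0 x p).
  { induction p as [|q p IH] using rev_ind; intros Hn.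
    - simpl; unfold A, lsum, wsum; simpl; lra.
    - assert (Hn' := lsum_greedy x s Hg (p ++ q :: nil) Hn).
      assert (Hp : NoDup p) by (apply NoDup_app_remove_r in Hn; assumption).
      specialize (IH Hp).
      set (m := length p) in *.
      assert (Hl : length (p ++ q :: nil) = S m)
        by (rewrite length_app; simpl; unfold m; lia).
      rewrite Hl in *.
      assert (E1 : forall l b, A (l ++ b :: nil) = A l + Rabs (x b)).
      { intros l b. unfold A; rewrite lsum_app, lsum_cons. unfold lsum; simpl; lra. }
      assert (E2 : forall l b, wsum w 0 x (l ++ b :: nil) =
                     wsum w 0 x l + w (length l) * Rabs (x b)).
      { intros l b. unfold wsum; rewrite psum_app; simpl; lra. }
      change (A (p ++ q :: nil) <= A (map s (seq 0 (S m)))) in Hn'.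
      rewrite seq_S, map_app in *. simpl map in *. rewrite !E1, !E2 in *.
      rewrite length_map, length_seq. fold m.
      assert (H1 : w (S m) <= w m) by apply Hw.
      set (D := A (map s (seq 0 m)) + Rabs (x (s m)) - (A p + Rabs (x q))).
      assert (0 <= D) by (unfold D; simpl in *; lra).
      assert (w (S m) * D <= w m * D) by (apply Rmult_le_compat_r; assumption).
      assert (w m * D = w m * (A (map s (seq 0 m)) - A p) + w m * Rabs (x (s m)) - w m * Rabs (x q))
        by (unfold D; ring).
      unfold D in *; simpl in *; lra. }
  intros p Hp. specialize (H p Hp).
  assert (H2 := lsum_greedy x s Hg p Hp). fold A in H2.
  assert (0 <= w (length p) * (A (map s (seq 0 (length p))) - A p))
    by (apply Rmult_le_pos; [now apply weight_nonneg | lra]).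
  lra.
Qed.

Lemma wsum_xstar w x s : greedy x s -> forall m,
  sum_n (fun n => w n * xstar x n) m = wsum w 0 x (map s (seq 0 (S m))).
Proof.
  intros Hg; induction m.
  - rewrite sum_O; simpl. unfold wsum; simpl. rewrite (xstar_greedy x s Hg); lra.
  - rewrite sum_Sn, (seq_S (S m)), map_app, IHm. unfold wsum; rewrite psum_app.
    rewrite length_map, length_seq. simpl. rewrite (xstar_greedy x s Hg).
    unfold plus; simpl; lra.
Qed.

(** * The norm as a supremum over injective lists *)

Lemma wsum_le_dnorm w x p : weight w -> in_d w x -> NoDup p -> wsum w 0 x p <= dnorm w x.
Proof.
  intros Hw [Hx Hs] Hp. destruct (greedy_exists x Hx) as [s Hg].
  eapply Rle_trans; [now apply (wsum_greedy w x s)|].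
  apply Series_correct in Hs.
  (* This partial sum has [length p + 1] terms; the extra one is nonnegative, and the empty list
     needs no separate case. *)
  apply Rle_trans with (sum_n (fun n => w n * xstar x n) (length p)).
  - rewrite (wsum_xstar w x s Hg), seq_S, map_app. unfold wsum at 2; rewrite psum_app.
    assert (H := wsum_nonneg w (0 + length (map s (seq 0 (length p)))) x
      (map s ((0 + length p)%nat :: nil)) Hw).
    unfold wsum in *; lra.
  - apply (is_lim_seq_incr_compare (sum_n (fun n => w n * xstar x n)) (dnorm w x)).
    + exact Hs.
    + intros n. rewrite sum_Sn. unfold plus; simpl.
      rewrite (xstar_greedy x s Hg).
      assert (0 <= w (S n) * Rabs (x (s (S n))))
        by (apply Rmult_le_pos; [now apply weight_nonneg | apply Rabs_pos]).
      lra.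
Qed.

Lemma frequently_list (P : nat -> Prop) :
  (forall N, exists n, (N <= n)%nat /\ P n) ->
  forall m, exists l, NoDup l /\ length l = m /\ forall k, In k l -> P k.
Proof.
  intros H; induction m as [|m (l & Hl & Hm & HP)].
  - exists nil; repeat split; [constructor | simpl; tauto].
  - destruct (exists_not_in l) as [N HN]. destruct (H N) as (n & Hn & Hp).
    exists (n :: l); repeat split; simpl.
    + constructor; [|assumption]. intros Hi; specialize (HN n Hi); lia.
    + now rewrite Hm.
    + intros k [<-|Hk]; auto.
Qed.

Lemma not_lim0_frequently (x : nat -> R) : ~ is_lim_seq x 0 ->
  exists eps, 0 < eps /\ forall N, exists n, (N <= n)%nat /\ eps < Rabs (x n).
Proof.
  intros H. apply NNPP; intros Hc; apply H, lim0_iff. intros eps He.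
  apply NNPP; intros Hn; apply Hc. exists eps; split; [assumption|].
  intros N. apply NNPP; intros Hm; apply Hn. exists N; intros n Hnn.
  apply Rnot_lt_le; intros Hlt; apply Hm; exists n; auto.
Qed.

(** Divergence survives a shift, because the first [N] weights add up to at most [N]. *)
Lemma psum_const_unbounded (A : Type) w N c B : weight w -> 0 < c ->
  exists m, forall (l : list A), length l = m -> B < psum w N (fun _ => c) l.
Proof.
  intros Hw Hc.
  assert (E : forall m (l : list A), length l = S m ->
     psum w 0 (fun _ => c) l = c * sum_n w m).
  { induction m as [|m IH]; intros l Hl.
    - destruct l as [|a [|b l]]; try discriminate. rewrite sum_O; simpl; lra.
    - destruct (exists_last (l := l)) as (l' & a & ->); [now destruct l|].
      rewrite length_app in Hl; simpl in Hl.
      rewrite psum_app, (IH l') by lia. rewrite sum_Sn. simpl.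
      replace (length l') with (S m) by lia. unfold plus; simpl; lra. }
  assert (HN : forall l : list A, psum w 0 (fun _ => c) (firstn N l) <= c * INR N).
  { intros l. assert (length (firstn N l) <= N)%nat by (rewrite length_firstn; lia).
    revert H; generalize (firstn N l) as l', 0%nat as k. intros l'; revert N.
    induction l' as [|a l' IH]; intros N k Hl; simpl.
    - apply Rmult_le_pos; [lra | apply pos_INR].
    - destruct N as [|N]; [simpl in Hl; lia|]. rewrite S_INR.
      specialize (IH N (S k)). simpl in Hl.
      assert (H1 := weight_le_1 w Hw k).
      assert (w k * c <= 1 * c) by (apply Rmult_le_compat_r; lra).
      specialize (IH ltac:(lia)). lra. }
  destruct (Hw) as (_ & _ & _ & Hinf). apply is_lim_seq_spec in Hinf.
  destruct (Hinf ((B + c * INR N) / c)) as [m Hm].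
  specialize (Hm (m + N)%nat ltac:(lia)).
  exists (S m). intros l Hl.
  destruct l as [|a l]; [discriminate|].
  (* Padding with [N] entries turns the shifted sum into an unshifted one. The summand is constant,
     so any entry will do; the length [S m] guarantees that one exists. *)
  set (pre := repeat a N).
  assert (E1 : psum w 0 (fun _ => c) (pre ++ a :: l) = c * sum_n w (m + N)%nat).
  { apply E. unfold pre; rewrite length_app, repeat_length, Hl. lia. }
  rewrite psum_app in E1. unfold pre in E1 at 2. rewrite repeat_length in E1.
  assert (H2 := HN pre). rewrite firstn_all2 in H2 by (unfold pre; rewrite repeat_length; lia).
  rewrite Nat.add_0_l in E1.
  apply (Rmult_lt_compat_l c) in Hm; [|assumption].
  replace (c * ((B + c * INR N) / c)) with (B + c * INR N) in Hm by (field; lra).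
  lra.
Qed.

(** The other half of the supremum formula; after it [xstar] is no longer needed. Convergence to 0
    comes from the divergence of the weights: infinitely many entries above some [eps] would make
    the sums unbounded. *)
Lemma in_d_of_bound w x C : weight w ->
  (forall p, NoDup p -> wsum w 0 x p <= C) -> in_d w x /\ dnorm w x <= C.
Proof.
  intros Hw HC.
  assert (Hx : is_lim_seq x 0).
  { apply NNPP; intros Hn. destruct (not_lim0_frequently x Hn) as (eps & He & Hf).
    destruct (psum_const_unbounded nat w 0 eps C Hw He) as [m Hm].
    destruct (frequently_list _ Hf m) as (l & Hl & Hlen & HP).
    specialize (Hm l Hlen). specialize (HC l Hl).
    assert (psum w 0 (fun _ => eps) l <= wsum w 0 x l).
    { apply psum_le; [now apply weight_nonneg|].
      intros a Ha; specialize (HP a Ha); lra. }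
    lra. }
  destruct (greedy_exists x Hx) as [s Hg].
  assert (Hb : forall m, sum_n (fun n => w n * xstar x n) m <= C).
  { intros m. rewrite (wsum_xstar w x s Hg). apply HC. now apply (greedy_NoDup x). }
  assert (Hs : ex_series (fun n => w n * xstar x n)).
  { destruct (ex_finite_lim_seq_incr (sum_n (fun n => w n * xstar x n)) C) as [l Hl].
    - intros n. rewrite sum_Sn. unfold plus; simpl. rewrite (xstar_greedy x s Hg).
      assert (0 <= w (S n) * Rabs (x (s (S n))))
        by (apply Rmult_le_pos; [now apply weight_nonneg | apply Rabs_pos]).
      lra.
    - assumption.
    - now exists l. }
  split; [split; assumption|].
  apply Series_correct in Hs.
  apply (is_lim_seq_le (sum_n (fun n => w n * xstar x n)) (fun _ => C) (dnorm w x) C).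
  - assumption.
  - exact Hs.
  - apply is_lim_seq_const.
Qed.

Lemma dnorm_nonneg w x : weight w -> in_d w x -> 0 <= dnorm w x.
Proof. intros Hw Hx. apply (wsum_le_dnorm w x nil Hw Hx). constructor. Qed.

Lemma coord_le_dnorm w x k : weight w -> in_d w x -> Rabs (x k) <= dnorm w x.
Proof.
  intros Hw Hx. assert (H := wsum_le_dnorm w x (k :: nil) Hw Hx).
  destruct Hw as (H1 & _). unfold wsum in H; simpl in H. rewrite H1 in H.
  specialize (H ltac:(repeat constructor; simpl; tauto)). lra.
Qed.

Lemma dnorm_approx w x eps : weight w -> in_d w x -> 0 < eps ->
  exists p, NoDup p /\ dnorm w x - eps < wsum w 0 x p.
Proof.
  intros Hw Hx He. apply NNPP; intros Hn.
  destruct (in_d_of_bound w x (dnorm w x - eps) Hw) as [_ H]; [|lra].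
  intros p Hp. apply Rnot_lt_le; intros Hlt; apply Hn; exists p; auto.
Qed.

Lemma in_d_vadd w x y : weight w -> in_d w x -> in_d w y ->
  in_d w (vadd x y) /\ dnorm w (vadd x y) <= dnorm w x + dnorm w y.
Proof.
  intros Hw Hx Hy. apply in_d_of_bound; [assumption|]. intros p Hp.
  apply Rle_trans with (wsum w 0 x p + wsum w 0 y p).
  - unfold wsum; rewrite <- psum_plus. apply psum_le; [now apply weight_nonneg|].
    intros a _; apply Rabs_triang.
  - apply Rplus_le_compat; now apply wsum_le_dnorm.
Qed.

Lemma in_d_vscal w c x : weight w -> in_d w x ->
  in_d w (vscal c x) /\ dnorm w (vscal c x) <= Rabs c * dnorm w x.
Proof.
  intros Hw Hx. apply in_d_of_bound; [assumption|]. intros p Hp.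
  unfold wsum, vscal.
  rewrite (psum_ext _ _ _ _ (fun k => Rabs c * Rabs (x k)))
    by (intros; apply Rabs_mult).
  rewrite psum_scal. apply Rmult_le_compat_l; [apply Rabs_pos|].
  now apply wsum_le_dnorm.
Qed.

Lemma in_d_vzero w : weight w -> in_d w vzero /\ dnorm w vzero <= 0.
Proof.
  intros Hw. apply in_d_of_bound; [assumption|]. intros p Hp. unfold wsum, vzero.
  rewrite (psum_ext _ _ _ _ (fun _ => 0)) by (intros; apply Rabs_R0).
  rewrite psum_zero; lra.
Qed.

Lemma vsub_vadd x y : vsub x y = vadd x (vscal (-1) y).
Proof. apply functional_extensionality; intros k; unfold vsub, vadd, vscal; ring. Qed.

Lemma in_d_vsub w x y : weight w -> in_d w x -> in_d w y -> in_d w (vsub x y).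
Proof.
  intros Hw Hx Hy. rewrite vsub_vadd.
  apply in_d_vadd; [assumption..|]. now apply in_d_vscal.
Qed.

(** * Shifted sums and tails of a single vector *)

(** Weights are at most 1, so the first [N] places cost at most [t] each. This converts small
    shifted sums into a small norm when all coordinates are small. *)
Lemma psum_split_small (A : Type) w M N (g : A -> R) t l : weight w -> 0 <= t ->
  (forall a, In a l -> 0 <= g a <= t) ->
  psum w M g l <= INR N * t + psum w (M + N) g (skipn N l).
Proof.
  intros Hw Ht; revert M l; induction N as [|N IH]; intros M l Hg.
  - simpl. rewrite Nat.add_0_r; lra.
  - rewrite S_INR. assert (0 <= INR N) by apply pos_INR.
    assert (0 <= INR N * t) by (apply Rmult_le_pos; assumption).
    destruct l as [|a l]; simpl; [lra|].
    specialize (IH (S M) l (fun b Hb => Hg b (or_intror Hb))).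
    rewrite Nat.add_succ_r. simpl in IH.
    destruct (Hg a (or_introl eq_refl)).
    assert (w M * g a <= 1 * g a)
      by (apply Rmult_le_compat_r; [assumption | now apply weight_le_1]).
    lra.
Qed.

Lemma NoDup_skipn (A : Type) N (l : list A) : NoDup l -> NoDup (skipn N l).
Proof.
  intros H. rewrite <- (firstn_skipn N l) in H. now apply NoDup_app_remove_l in H.
Qed.

Lemma In_skipn (A : Type) N (l : list A) a : In a (skipn N l) -> In a l.
Proof. intros H. rewrite <- (firstn_skipn N l). apply in_or_app; now right. Qed.

(** A nearly norming list [p0] leaves room for only [eps / 2] in whatever is appended to it, that
    is, in sums shifted by [length p0]. Far out the coordinates are so small that restoring the
    first [length p0] weights costs at most another [eps / 2]. *)
Lemma wsum_tail w x eps : weight w -> in_d w x -> 0 < eps ->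
  exists m, forall p, NoDup p -> (forall q, In q p -> (m <= q)%nat) -> wsum w 0 x p <= eps.
Proof.
  intros Hw Hx He.
  destruct (dnorm_approx w x (eps / 2) Hw Hx) as (p0 & Hp0 & Hn); [lra|].
  set (K := length p0).
  assert (HK : 0 <= INR K) by apply pos_INR.
  assert (Ht : 0 < eps / 2 / (INR K + 1)) by (apply Rdiv_lt_0_compat; lra).
  destruct (proj1 (lim0_iff x) (proj1 Hx) _ Ht) as [m1 Hm1].
  destruct (exists_not_in p0) as [m2 Hm2].
  exists (m1 + m2)%nat. intros p Hp Hq.
  set (t := eps / 2 / (INR K + 1)) in *.
  assert (H := psum_split_small nat w 0 K (fun k => Rabs (x k)) t p Hw (Rlt_le _ _ Ht)).
  assert (Hs : wsum w 0 x (p0 ++ skipn K p) <= dnorm w x).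
  { apply wsum_le_dnorm; [assumption..|]. apply NoDup_app; [assumption | now apply NoDup_skipn|].
    intros a Ha Hb. apply In_skipn, Hq in Hb. apply Hm2 in Ha. lia. }
  unfold wsum in *. rewrite psum_app in Hs. fold K in Hs.
  assert (INR K * t <= eps / 2).
  { replace (eps / 2) with ((INR K + 1) * t) by (unfold t; field; lra).
    apply Rmult_le_compat_r; lra. }
  enough (psum w 0 (fun k => Rabs (x k)) p <=
    INR K * t + psum w (0 + K) (fun k => Rabs (x k)) (skipn K p)) by lra.
  apply H. intros a Ha. split; [apply Rabs_pos|]. apply Hm1. apply Hq in Ha; lia.
Qed.

(** * Weakly null sequences and the gliding hump *)

Lemma bounded_op_bound w T : weight w -> bounded_op w T ->
  exists C, 0 <= C /\ forall x, in_d w x -> dnorm w (T x) <= C * dnorm w x.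
Proof.
  intros Hw (_ & _ & _ & C & HC). exists (Rabs C); split; [apply Rabs_pos|].
  intros x Hx. eapply Rle_trans; [now apply HC|].
  apply Rmult_le_compat_r; [now apply dnorm_nonneg | apply Rle_abs].
Qed.

Lemma bounded_functional_coord w k : weight w -> bounded_functional w (fun x => x k).
Proof.
  intros Hw; repeat split. exists 1. intros x Hx. rewrite Rmult_1_l.
  now apply coord_le_dnorm.
Qed.

Lemma bounded_functional_comp w f T : weight w ->
  bounded_functional w f -> bounded_op w T -> bounded_functional w (fun x => f (T x)).
Proof.
  intros Hw (Hf1 & Hf2 & C & Hf3) HT.
  destruct (bounded_op_bound w T Hw HT) as (D & HD & HTD).
  destruct HT as (HT0 & HT1 & HT2 & _). repeat split.
  - intros x y Hx Hy. rewrite HT1 by assumption. apply Hf1; auto.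
  - intros a x Hx. rewrite HT2 by assumption. apply Hf2; auto.
  - exists (Rabs C * D). intros x Hx. eapply Rle_trans; [apply Hf3; auto|].
    apply Rle_trans with (Rabs C * dnorm w (T x)).
    + apply Rmult_le_compat_r; [apply dnorm_nonneg; auto | apply Rle_abs].
    + rewrite Rmult_assoc. apply Rmult_le_compat_l; [apply Rabs_pos | auto].
Qed.

Lemma weakly_null_image w T xs : weight w -> bounded_op w T ->
  weakly_null w xs -> weakly_null w (fun n => T (xs n)).
Proof.
  intros Hw HT Hx f Hf. apply (Hx (fun x => f (T x))).
  now apply bounded_functional_comp.
Qed.

Lemma weakly_null_lsum w xs L eps : weight w -> weakly_null w xs -> 0 < eps ->
  exists n0, forall n, (n0 <= n)%nat -> lsum (fun k => Rabs (xs n k)) L <= eps.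
Proof.
  intros Hw Hx; revert eps; induction L as [|k L IH]; intros eps He.
  - exists O; intros. unfold lsum; simpl; lra.
  - destruct (IH (eps / 2)) as [n1 H1]; [lra|].
    assert (Hk := Hx (fun x => x k) (bounded_functional_coord w k Hw)).
    destruct (proj1 (lim0_iff _) Hk (eps / 2)) as [n2 H2]; [lra|].
    exists (n1 + n2)%nat; intros n Hn. rewrite lsum_cons.
    specialize (H1 n ltac:(lia)). specialize (H2 n ltac:(lia)). simpl in H2. lra.
Qed.

(* Gliding hump.  If the conclusion fails, disjoint finite blocks, each using a
   fresh range of the weights, add up to a functional [f] whose coefficients are
   dominated by an injective rearrangement of [w] (hence bounded), while [f] stays
   away from 0 along a subsequence. *)
Lemma weakly_null_uniform_tail w xs eps : weight w ->
  (forall n, in_d w (xs n)) -> weakly_null w xs -> 0 < eps ->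
  exists N n0, forall n p, (n0 <= n)%nat -> NoDup p -> wsum w N (xs n) p <= eps.
Proof.
  intros Hw Hd Hx He. apply NNPP; intros Hc.
  assert (H : forall N n0, exists n p, (n0 <= n)%nat /\ NoDup p /\ eps < wsum w N (xs n) p).
  { intros N n0. apply NNPP; intros Hn. apply Hc. exists N, n0. intros n p H1 H2.
    apply Rnot_lt_le; intros H3; apply Hn; exists n, p; auto. }
  clear Hc.
  (* A block holds coordinates with signs, the index of the vector it tests, and a bound [top]
     beyond which it has no coordinates and that vector is negligible. *)
  set (ev := fun (x : nat -> R) (c : nat * R) => snd c * x (fst c)).
  set (blk := (list (nat * R) * nat * nat)%type).
  set (B := fun a : blk => fst (fst a)).
  set (idx := fun a : blk => snd (fst a)).
  set (top := fun a : blk => snd a).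
  destruct (history_choice blk (fun h a =>
    let L := flat_map B h in
    NoDup (map fst (B a)) /\
    (forall c, In c (B a) -> (forall b, In b h -> (top b <= fst c)%nat) /\
       (fst c < top a)%nat /\ Rabs (snd c) <= 1) /\
    3 / 4 * eps < psum w (length L) (ev (xs (idx a))) (B a) /\
    lsum (fun k => Rabs (xs (idx a) k)) (map fst L) <= eps / 4 /\
    (length h <= idx a)%nat /\
    (forall p, NoDup p -> (forall q, In q p -> (top a <= q)%nat) ->
       wsum w 0 (xs (idx a)) p <= eps / 4))) as [s Hs].
  { intros h. set (L := flat_map B h).
    destruct (exists_not_in (map top h)) as [M HM].
    destruct (weakly_null_lsum w xs (map fst L) (eps / 4) Hw Hx) as [n1 Hn1]; [lra|].
    destruct (weakly_null_lsum w xs (seq 0 M) (eps / 4) Hw Hx) as [n2 Hn2]; [lra|].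
    destruct (H (length L) (n1 + n2 + length h)%nat) as (n & p & Hn & Hp & Hlt).
    (* Coordinates below [M], where the earlier blocks live, are dropped. They contribute at most
       [eps / 4], because [xs n] is already small there. *)
    set (p' := filter (fun q => Nat.leb M q) p).
    set (sg := fun q => if Rle_dec 0 (xs n q) then 1 else -1).
    destruct (wsum_tail w (xs n) (eps / 4) Hw (Hd n)) as [m Hm]; [lra|].
    destruct (exists_not_in p') as [m' Hm'].
    assert (Hp' : NoDup p') by (apply NoDup_filter; assumption).
    exists (map (fun q => (q, sg q)) p', n, (m + m')%nat).
    unfold B, idx, top; simpl.
    rewrite map_map; simpl; rewrite map_id.
    split; [assumption|]. split; [|split; [|split; [|split]]].
    - intros c Hc. apply in_map_iff in Hc as (q & <- & Hq). simpl. repeat split.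
      + intros b Hb. unfold p' in Hq; rewrite filter_In in Hq.
        destruct Hq as [_ Hq]. apply Nat.leb_le in Hq.
        assert (top b < M)%nat by (apply HM, in_map; assumption).
        unfold top in *; lia.
      + apply Hm' in Hq; lia.
      + unfold sg. destruct (Rle_dec 0 (xs n q)); [rewrite Rabs_R1 | rewrite Rabs_left]; lra.
    - rewrite psum_map. fold L.
      assert (Hf := psum_filter w (length L) (fun k => Rabs (xs n k))
        (fun q => Nat.leb M q) p Hw (fun k => Rabs_pos _)).
      fold p' in Hf.
      assert (Hi : lsum (fun k => Rabs (xs n k)) (filter (fun a => negb (M <=? a)) p)
                 <= lsum (fun k => Rabs (xs n k)) (seq 0 M)).
      { apply lsum_incl; [intros; apply Rabs_pos | now apply NoDup_filter|].
        intros q Hq. apply filter_In in Hq as [_ Hq].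
        apply Bool.negb_true_iff, Nat.leb_gt in Hq. apply in_seq; lia. }
      specialize (Hn2 n ltac:(lia)).
      unfold wsum in Hlt.
      rewrite (psum_ext _ _ _ _ (fun k => Rabs (xs n k))); [lra|].
      intros q _. unfold ev, sg; simpl.
      destruct (Rle_dec 0 (xs n q)); [rewrite Rabs_pos_eq | rewrite Rabs_left]; lra.
    - apply Hn1; lia.
    - lia.
    - intros q Hq Hge. apply Hm; [assumption|]. intros r Hr; apply Hge in Hr; lia. }
  set (L := fun k => flat_map B (map s (seq 0 k))).
  assert (LS : forall k, L (S k) = L k ++ B (s k)).
  { intros k; unfold L. rewrite seq_S, map_app, flat_map_app; simpl.
    now rewrite app_nil_r. }
  assert (LIn : forall k c, In c (L k) -> exists j, (j < k)%nat /\ In c (B (s j))).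
  { intros k c Hc. apply in_flat_map in Hc as (b & Hb & Hc).
    apply in_map_iff in Hb as (j & <- & Hj). apply in_seq in Hj.
    exists j; split; [lia | assumption]. }
  assert (sIn : forall j k, (j < k)%nat -> In (s j) (map s (seq 0 k)))
    by (intros j k Hj; apply in_map, in_seq; lia).
  assert (LND : forall k, NoDup (map fst (L k))).
  { induction k; [constructor|]. rewrite LS, map_app.
    destruct (Hs k) as (H1 & H2 & _).
    apply NoDup_app; [assumption..|].
    intros q Hq Hq'. apply in_map_iff in Hq as (c & <- & Hc).
    apply in_map_iff in Hq' as (c' & E & Hc').
    apply LIn in Hc as (j & Hj & Hc).
    apply H2 in Hc' as (Hc' & _). specialize (Hc' (s j) (sIn j k Hj)).
    apply (proj1 (proj2 (Hs j))) in Hc. lia. }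
  assert (Lpre : forall k d, exists rest, L (k + d)%nat = L k ++ rest /\
     forall c j, In c rest -> (j < k)%nat -> (top (s j) <= fst c)%nat).
  { intros k; induction d as [|d (rest & E & Hr)].
    - exists nil. rewrite Nat.add_0_r, app_nil_r. split; [reflexivity | simpl; tauto].
    - exists (rest ++ B (s (k + d)%nat)). rewrite Nat.add_succ_r, LS, E, app_assoc.
      split; [reflexivity|]. intros c j Hc Hj. apply in_app_or in Hc as [Hc|Hc]; [auto|].
      apply (proj1 (proj2 (Hs (k + d)%nat))) in Hc as (Hc & _). apply Hc, sIn; lia. }
  assert (Labs : forall k x N rest, incl rest (L k) ->
     Rabs (psum w N (ev x) rest) <= wsum w N x (map fst rest)).
  { intros k x N rest Hi. eapply Rle_trans; [apply psum_abs; now apply weight_nonneg|].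
    unfold wsum; rewrite psum_map. apply psum_le; [now apply weight_nonneg|].
    intros c Hc. unfold ev. rewrite Rabs_mult.
    apply Hi, LIn in Hc as (j & _ & Hc).
    apply (proj1 (proj2 (Hs j))) in Hc as (_ & _ & Hc).
    rewrite <- (Rmult_1_l (Rabs (x (fst c)))) at 2.
    apply Rmult_le_compat_r; [apply Rabs_pos | assumption]. }
  (* Partial sums of the functional, and a majorant for their increments. The coordinates in [L k]
     are distinct, so [a x] is bounded by the norm; it is also monotone, hence Cauchy, and [b x]
     inherits this. *)
  set (b := fun x k => psum w 0 (ev x) (L k)).
  set (a := fun x k => wsum w 0 x (map fst (L k))).
  assert (Hab : forall x k d, Rabs (b x (k + d)%nat - b x k) <= a x (k + d)%nat - a x k).
  { intros x k d. destruct (Lpre k d) as (rest & E & _).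
    unfold a, b, wsum. rewrite E, map_app, !psum_app, length_map.
    replace (psum w 0 (ev x) (L k) + psum w (0 + length (L k)) (ev x) rest - psum w 0 (ev x) (L k))
      with (psum w (0 + length (L k)) (ev x) rest) by ring.
    eapply Rle_trans; [apply (Labs (k + d)%nat)|unfold wsum; lra].
    rewrite E. intros c Hc; apply in_or_app; now right. }
  assert (Ha : forall x k, in_d w x -> a x k <= dnorm w x)
    by (intros x k Hxd; apply wsum_le_dnorm; auto).
  assert (Hlim : forall x, in_d w x -> is_lim_seq (b x) (real (Lim_seq (b x)))).
  { intros x Hxd. apply Lim_seq_correct'.
    assert (Hal : ex_finite_lim_seq (a x)).
    { apply (ex_finite_lim_seq_incr (a x) (dnorm w x)); [|auto].
      intros k. specialize (Hab x k 1%nat). rewrite Nat.add_1_r in Hab.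
      assert (H0 := Rabs_pos (b x (S k) - b x k)). lra. }
    apply ex_lim_seq_cauchy_corr in Hal. apply ex_lim_seq_cauchy_corr.
    assert (Hmn : forall k l, Rabs (b x k - b x l) <= Rabs (a x k - a x l)).
    { intros k l. destruct (Nat.le_ge_cases l k) as [Hlk|Hlk].
      - replace k with (l + (k - l))%nat by lia.
        eapply Rle_trans; [apply Hab | apply Rle_abs].
      - replace l with (k + (l - k))%nat by lia.
        rewrite Rabs_minus_sym, (Rabs_minus_sym (a x k)).
        eapply Rle_trans; [apply Hab | apply Rle_abs]. }
    intros e. destruct (Hal e) as [N HN]. exists N. intros n m Hn Hm.
    eapply Rle_lt_trans; [apply Hmn | auto]. }
  set (f := fun x => real (Lim_seq (b x))).
  assert (Hf : bounded_functional w f).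
  { repeat split.
    - intros x y Hxd Hyd. unfold f.
      assert (E : is_lim_seq (b (vadd x y)) (f x + f y)).
      { apply is_lim_seq_ext with (fun k => b x k + b y k).
        - intros k. unfold b. rewrite <- psum_plus. apply psum_ext.
          intros c _; unfold ev, vadd; ring.
        - apply is_lim_seq_plus'; now apply Hlim. }
      apply is_lim_seq_unique in E. now rewrite E.
    - intros c x Hxd. unfold f.
      assert (E : is_lim_seq (b (vscal c x)) (c * f x)).
      { apply is_lim_seq_ext with (fun k => c * b x k).
        - intros k. unfold b. rewrite <- psum_scal. apply psum_ext.
          intros c' _; unfold ev, vscal; ring.
        - apply (is_lim_seq_scal_l (b x) c (f x)). now apply Hlim. }
      apply is_lim_seq_unique in E. now rewrite E.
    - exists 1. intros x Hxd. rewrite Rmult_1_l.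
      apply (is_lim_seq_le (fun k => Rabs (b x k)) (fun _ => dnorm w x) (Rabs (f x)) (dnorm w x)).
      + intros k. eapply Rle_trans; [apply (Labs k); apply incl_refl | now apply Ha].
      + apply (is_lim_seq_abs (b x) (f x)). now apply Hlim.
      + apply is_lim_seq_const. }
  destruct (proj1 (lim0_iff _) (Hx f Hf) (eps / 8)) as [k Hk]; [lra|].
  destruct (Hs k) as (H1 & H2 & H3 & H4 & H5 & H6).
  rewrite length_map, length_seq in H5. fold (L k) in H3, H4.
  set (n := idx (s k)) in *. specialize (Hk n H5). simpl in Hk.
  (* Every partial sum past block [k] splits into earlier blocks, block [k] and later blocks; the
     later ones lie beyond [top (s k)]. The bound contradicts the choice of [eps / 8] for [Hk]. *)
  assert (Hge : eps / 4 <= f (xs n)).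
  { apply (is_lim_seq_le_loc (fun _ => eps / 4) (b (xs n)) (eps / 4) (f (xs n))).
    - exists (S k). intros K HK. destruct (Lpre (S k) (K - S k)%nat) as (rest & E & Hr).
      replace (S k + (K - S k))%nat with K in E by lia.
      unfold b. rewrite E, LS, !psum_app.
      assert (P1 := Labs k (xs n) 0%nat (L k) (incl_refl _)).
      assert (P2 : Rabs (psum w (0 + length (L k ++ B (s k))) (ev (xs n)) rest) <= eps / 4).
      { eapply Rle_trans; [apply (Labs K)|].
        - rewrite E. intros c Hc; apply in_or_app; now right.
        - eapply Rle_trans; [apply (wsum_shift w 0); [assumption|lia]|].
          apply H6.
          + specialize (LND K). rewrite E, map_app in LND. now apply NoDup_app_remove_l in LND.
          + intros q Hq. apply in_map_iff in Hq as (c & <- & Hc). apply Hr; [assumption|lia]. }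
      assert (P3 : wsum w 0 (xs n) (map fst (L k)) <= eps / 4).
      { eapply Rle_trans; [apply psum_le_lsum; [assumption | intros; apply Rabs_pos]|]. exact H4. }
      apply Rabs_le_between in P2.
      assert (P4 : Rabs (psum w 0 (ev (xs n)) (L k)) <= eps / 4) by lra.
      apply Rabs_le_between in P4.
      rewrite Nat.add_0_l in P2. rewrite !Nat.add_0_l. lra.
    - apply is_lim_seq_const.
    - apply Hlim, Hd. }
  assert (Hle := Rle_abs (f (xs n))). lra.
Qed.

(** * Unit vectors and finite sections *)

Definition unit_vec (k : nat) : nat -> R := fun j => if Nat.eq_dec j k then 1 else 0.

(** Built as a combination of unit vectors, so that linear maps can be evaluated by induction. A
    repeated index counts repeatedly, hence [NoDup] in [restrict_at]. *)
Definition restrict (x : nat -> R) (l : list nat) : nat -> R :=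
  fold_right (fun k v => vadd (vscal (x k) (unit_vec k)) v) vzero l.

Lemma psum_const_le (A : Type) w N (l : list A) : weight w ->
  psum w N (fun _ => 1) l <= w N * INR (length l).
Proof.
  intros Hw; induction l as [|a l IH]; [simpl; lra|].
  change (length (a :: l)) with (S (length l)). rewrite S_INR; simpl.
  assert (psum w (S N) (fun _ => 1) l <= psum w N (fun _ => 1) l)
    by (apply psum_shift; [assumption | lia | intros; lra]).
  lra.
Qed.

(** By monotonicity a nonpositive weight would keep all sums from there on nonpositive, against
    divergence. *)
Lemma weight_pos w : weight w -> forall n, 0 < w n.
Proof.
  intros Hw n.
  destruct (psum_const_unbounded nat w n 1 0 Hw) as [m Hm]; [lra|].
  specialize (Hm (seq 0 m) (length_seq m 0)).
  assert (H := psum_const_le nat w n (seq 0 m) Hw).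
  apply Rnot_le_lt; intros Hn.
  assert (w n * INR (length (seq 0 m)) <= 0 * INR (length (seq 0 m)))
    by (apply Rmult_le_compat_r; [apply pos_INR | assumption]).
  lra.
Qed.

(** At most [length l] entries of [p] matter: the first [N] of them cost at most 1 each, the others
    at most [w N] each. Since [w N] tends to 0, sign vectors on [m] coordinates have norm o(m). *)
Lemma wsum_supported_le w N x l p : weight w -> NoDup l -> NoDup p ->
  (forall k, Rabs (x k) <= 1) -> (forall k, ~ In k l -> x k = 0) ->
  wsum w 0 x p <= INR N + w N * INR (length l).
Proof.
  intros Hw Hl Hp H1 H0.
  set (P := fun k => if in_dec Nat.eq_dec k l then true else false).
  assert (Hf := psum_filter w 0 (fun k => Rabs (x k)) P p Hw (fun k => Rabs_pos _)).
  assert (Hz : lsum (fun k => Rabs (x k)) (filter (fun a => negb (P a)) p) <= 0).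
  { unfold lsum. rewrite (psum_ext _ _ _ _ (fun _ => 0)).
    - rewrite psum_zero; lra.
    - intros k Hk. apply filter_In in Hk as [_ Hk]. unfold P in Hk.
      destruct (in_dec Nat.eq_dec k l); [discriminate|].
      rewrite H0 by assumption. apply Rabs_R0. }
  set (p' := filter P p) in *.
  assert (Hlen : (length p' <= length l)%nat).
  { apply NoDup_incl_length; [now apply NoDup_filter|].
    intros k Hk. apply filter_In in Hk as [_ Hk]. unfold P in Hk.
    destruct (in_dec Nat.eq_dec k l); [assumption | discriminate]. }
  assert (Hs : psum w 0 (fun k => Rabs (x k)) p' <= INR N * 1 +
            psum w (0 + N) (fun k => Rabs (x k)) (skipn N p')).
  { apply psum_split_small; [assumption | lra |]. intros a _; split; [apply Rabs_pos | auto]. }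
  assert (Ht : psum w N (fun k => Rabs (x k)) (skipn N p') <= w N * INR (length (skipn N p'))).
  { eapply Rle_trans; [|now apply psum_const_le].
    apply psum_le; [now apply weight_nonneg | auto]. }
  assert (w N * INR (length (skipn N p')) <= w N * INR (length l)).
  { apply Rmult_le_compat_l; [now apply weight_nonneg|]. apply le_INR.
    rewrite length_skipn; lia. }
  unfold wsum. rewrite Nat.add_0_l in Hs. lra.
Qed.

Lemma in_d_unit_vec w k : weight w -> in_d w (unit_vec k) /\ dnorm w (unit_vec k) <= 1.
Proof.
  intros Hw. apply in_d_of_bound; [assumption|]. intros p Hp.
  assert (H := wsum_supported_le w 0 (unit_vec k) (k :: nil) p Hw).
  destruct Hw as (H1 & _). simpl in H. rewrite H1 in H.
  enough (wsum w 0 (unit_vec k) p <= 0 + 1 * 1) by lra.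
  apply H; [repeat constructor; simpl; tauto | assumption | |].
  - intros j; unfold unit_vec. destruct (Nat.eq_dec j k); [rewrite Rabs_R1 | rewrite Rabs_R0]; lra.
  - intros j Hj; unfold unit_vec. destruct (Nat.eq_dec j k); [subst; tauto | reflexivity].
Qed.

Lemma in_d_restrict w x l : weight w -> in_d w (restrict x l).
Proof.
  intros Hw; induction l as [|k l IH]; simpl; [now apply in_d_vzero|].
  apply in_d_vadd; [assumption | | assumption].
  apply in_d_vscal; [assumption|]. now apply in_d_unit_vec.
Qed.

Lemma restrict_at x l j : NoDup l ->
  restrict x l j = if in_dec Nat.eq_dec j l then x j else 0.
Proof.
  induction l as [|k l IH]; intros Hl; [reflexivity|].
  inversion Hl as [|? ? Hk Hl']; subst. specialize (IH Hl').
  change (x k * unit_vec k j + restrict x l j =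
    if in_dec Nat.eq_dec j (k :: l) then x j else 0).
  rewrite IH. unfold unit_vec.
  destruct (in_dec Nat.eq_dec j (k :: l)) as [Hi|Hi], (in_dec Nat.eq_dec j l) as [Hj|Hj],
    (Nat.eq_dec j k) as [->|Hne]; simpl in Hi; try (exfalso; intuition congruence); try ring.
Qed.

Lemma functional_vzero w f : weight w -> bounded_functional w f -> f vzero = 0.
Proof.
  intros Hw (_ & Hf & _).
  replace vzero with (vscal 0 vzero)
    by (apply functional_extensionality; intros; unfold vscal, vzero; ring).
  rewrite Hf by now apply in_d_vzero. ring.
Qed.

Lemma functional_restrict w f x l : weight w -> bounded_functional w f ->
  f (restrict x l) = lsum (fun k => x k * f (unit_vec k)) l.
Proof.
  intros Hw Hf; induction l as [|k l IH].
  - simpl. rewrite (functional_vzero w) by assumption. reflexivity.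
  - rewrite lsum_cons, <- IH. destruct Hf as (Hf1 & Hf2 & _). simpl.
    destruct (in_d_unit_vec w k Hw) as [Hk _].
    rewrite Hf1, Hf2; [reflexivity | assumption | | now apply in_d_restrict].
    now apply in_d_vscal.
Qed.

Lemma op_restrict_norm w T x l : weight w -> bounded_op w T ->
  dnorm w (T (restrict x l)) <= lsum (fun k => Rabs (x k) * dnorm w (T (unit_vec k))) l.
Proof.
  intros Hw HT.
  destruct (bounded_op_bound w T Hw HT) as (C & _ & HC).
  induction l as [|k l IH].
  - simpl. destruct (in_d_vzero w Hw) as [H0 H1].
    assert (E : dnorm w vzero = 0) by (apply Rle_antisym; [assumption | now apply dnorm_nonneg]).
    specialize (HC vzero H0). rewrite E in HC. unfold lsum; simpl; lra.
  - rewrite lsum_cons. destruct HT as (HT0 & HT1 & HT2 & _). simpl.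
    destruct (in_d_unit_vec w k Hw) as [Hk _].
    assert (Hr := in_d_restrict w x l Hw).
    assert (Hs := in_d_vscal w (x k) (unit_vec k) Hw Hk).
    rewrite HT1, HT2 by tauto.
    destruct (in_d_vscal w (x k) (T (unit_vec k)) Hw (HT0 _ Hk)) as [H1 H2].
    destruct (in_d_vadd w _ _ Hw H1 (HT0 _ Hr)) as [_ H3]. lra.
Qed.

Lemma lsum_const_le c f l : (forall k, In k l -> c <= f k) -> INR (length l) * c <= lsum f l.
Proof.
  induction l as [|k l IH]; intros H.
  - unfold lsum; simpl; lra.
  - rewrite lsum_cons. change (length (k :: l)) with (S (length l)). rewrite S_INR.
    specialize (IH (fun j Hj => H j (or_intror Hj))).
    specialize (H k (or_introl eq_refl)). lra.
Qed.

(** If [f] exceeded [eps] in modulus on infinitely many unit vectors, a signed sum of [m] of them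
    would have value at least [m * eps] but norm o(m). *)
Lemma unit_vec_weakly_null w : weight w -> weakly_null w unit_vec.
Proof.
  intros Hw f Hf. apply NNPP; intros Hn.
  destruct (not_lim0_frequently _ Hn) as (eps & He & Hfr).
  destruct (Hf) as (_ & _ & C0 & HC0).
  set (C := Rabs C0 + 1). assert (0 <= Rabs C0) by apply Rabs_pos.
  assert (HCp : 0 < C) by (unfold C; lra).
  (* [N] keeps the share [C * w N * m] within half of [m * eps]; the choice of [m] below then puts
     [C * N] strictly under the other half. *)
  destruct (proj1 (lim0_iff w) (proj1 (proj2 (proj2 Hw))) (eps / (2 * C))) as [N HN].
  { apply Rdiv_lt_0_compat; lra. }
  specialize (HN N (Nat.le_refl _)). rewrite Rabs_pos_eq in HN by now apply weight_nonneg.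
  destruct (INR_archimed eps (2 * C * INR N) He) as [m Hm].
  destruct (frequently_list _ Hfr m) as (l & Hl & Hlen & HP).
  set (sg := fun k => if Rle_dec 0 (f (unit_vec k)) then 1 else -1).
  assert (Hsg : forall k, sg k * f (unit_vec k) = Rabs (f (unit_vec k))).
  { intros k; unfold sg. destruct (Rle_dec 0 (f (unit_vec k)));
      [rewrite Rabs_pos_eq | rewrite Rabs_left]; lra. }
  assert (Hb : dnorm w (restrict sg l) <= INR N + w N * INR m).
  { rewrite <- Hlen. apply in_d_of_bound; [assumption|]. intros p Hp.
    apply wsum_supported_le; try assumption; intros k.
    - rewrite restrict_at by assumption. destruct (in_dec Nat.eq_dec k l).
      + unfold sg. destruct (Rle_dec 0 (f (unit_vec k)));
          [rewrite Rabs_R1 | rewrite Rabs_left]; lra.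
      + rewrite Rabs_R0; lra.
    - intros Hk. rewrite restrict_at by assumption.
      destruct (in_dec Nat.eq_dec k l); [contradiction | reflexivity]. }
  assert (Hd := in_d_restrict w sg l Hw).
  assert (Hge : INR m * eps <= f (restrict sg l)).
  { rewrite (functional_restrict w) by assumption. rewrite <- Hlen.
    apply lsum_const_le. intros k Hk. rewrite Hsg. specialize (HP k Hk). simpl in HP. lra. }
  specialize (HC0 _ Hd).
  assert (Hn0 := dnorm_nonneg w _ Hw Hd).
  assert (C0 * dnorm w (restrict sg l) <= C * dnorm w (restrict sg l)).
  { apply Rmult_le_compat_r; [assumption|]. unfold C. assert (H0 := Rle_abs C0). lra. }
  assert (C * dnorm w (restrict sg l) <= C * (INR N + w N * INR m))
    by (apply Rmult_le_compat_l; lra).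
  assert (w N * INR m <= eps / (2 * C) * INR m)
    by (apply Rmult_le_compat_r; [apply pos_INR | assumption]).
  assert (C * (w N * INR m) <= C * (eps / (2 * C) * INR m))
    by (apply Rmult_le_compat_l; lra).
  assert (E : C * (eps / (2 * C) * INR m) = eps * INR m / 2) by (field; lra).
  assert (Hr := Rle_abs (f (restrict sg l))). lra.
Qed.

(** Bounded operators preserve weak nullity, so the isomorphism [S] sends the unit vectors to a
    weakly null sequence in [Z]. Unit vectors have norm at least 1, so the images under [T] keep
    norm at least [c' * c]. *)
Lemma dunford_pettis_strictly_singular w T : weight w -> bounded_op w T ->
  dunford_pettis w T -> d_strictly_singular w T.
Proof.
  intros Hw HT HDP Z HZ (S & c & C & Hc & HSZ & _ & HS1 & HS2 & HSn) (c' & Hc' & HTZ).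
  destruct HZ as (HZd & _).
  assert (HS : bounded_op w S).
  { repeat split; [apply HZd; auto | apply HZd; auto | assumption | assumption |].
    exists C. intros x Hx. now apply HSn. }
  assert (Hu := fun n => proj1 (in_d_unit_vec w n Hw)).
  assert (Hl : is_lim_seq (fun n => dnorm w (T (S (unit_vec n)))) 0).
  { apply (HDP (fun n => S (unit_vec n))).
    - intros n; apply HZd, HSZ, Hu.
    - apply weakly_null_image; try assumption. now apply unit_vec_weakly_null. }
  assert (Hcc : 0 < c' * c) by (apply Rmult_lt_0_compat; assumption).
  destruct (proj1 (lim0_iff _) Hl (c' * c / 2)) as [N HN]; [lra|].
  specialize (HN N (Nat.le_refl _)). simpl in HN.
  assert (H1 := coord_le_dnorm w (unit_vec N) N Hw (Hu N)).
  unfold unit_vec at 1 in H1. destruct (Nat.eq_dec N N); [|congruence].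
  rewrite Rabs_R1 in H1.
  assert (H2 := proj1 (HSn _ (Hu N))).
  assert (H3 := HTZ _ (HSZ _ (Hu N))).
  assert (c * 1 <= c * dnorm w (unit_vec N)) by (apply Rmult_le_compat_l; lra).
  assert (c' * c <= c' * dnorm w (S (unit_vec N))) by (apply Rmult_le_compat_l; lra).
  assert (H4 := Rle_abs (dnorm w (T (S (unit_vec N))))). lra.
Qed.

(** * From the unit vectors to all weakly null sequences *)

(** On lists of bounded length the weights stay above a positive constant, so a weighted bound
    controls the plain sum of moduli. *)
Lemma psum_ge_lsum w N m (g : nat -> R) l : weight w -> (forall k, 0 <= g k) ->
  (length l <= m)%nat -> w (N + m)%nat * lsum g l <= psum w N g l.
Proof.
  intros Hw Hg; revert N m; induction l as [|k l IH]; intros N m Hl.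
  - unfold lsum; simpl; lra.
  - rewrite lsum_cons; simpl. simpl in Hl. destruct m as [|m]; [lia|].
    specialize (IH (S N) m ltac:(lia)). rewrite Nat.add_succ_r. simpl in IH.
    assert (w (S (N + m)) * g k <= w N * g k).
    { apply Rmult_le_compat_r; [apply Hg|]. apply weight_antitone; [assumption|lia]. }
    lra.
Qed.

Lemma lsum_filter f P l :
  lsum f l = lsum f (filter P l) + lsum f (filter (fun a => negb (P a)) l).
Proof.
  induction l as [|k l IH]; simpl; [unfold lsum; simpl; lra|].
  destruct (P k); simpl; rewrite !lsum_cons, IH; lra.
Qed.

Lemma lsum_scal c f l : lsum (fun k => c * f k) l = c * lsum f l.
Proof. apply psum_scal. Qed.

(* By [weakly_null_uniform_tail], up to a small error a weakly null sequence has
   boundedly many large coordinates, and these drift to infinity. *)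
Lemma dunford_pettis_of_basis w T : weight w -> bounded_op w T ->
  is_lim_seq (fun k => dnorm w (T (unit_vec k))) 0 -> dunford_pettis w T.
Proof.
  intros Hw HT Hb xs Hd Hx. apply lim0_iff. intros dl Hdl.
  destruct (bounded_op_bound w T Hw HT) as (C & HC & HTC).
  (* The small part will have norm at most [2 * eps], hence an image of norm at most [dl / 4];
     [C + 1] allows for [C = 0]. *)
  set (eps := dl / (8 * (C + 1))).
  assert (He : 0 < eps) by (apply Rdiv_lt_0_compat; lra).
  assert (HCe : C * (2 * eps) <= dl / 4).
  { replace (dl / 4) with ((C + 1) * (2 * eps)) by (unfold eps; field; lra).
    apply Rmult_le_compat_r; lra. }
  destruct (weakly_null_uniform_tail w xs eps Hw Hd Hx He) as (N & n0 & HN).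
  assert (HNp := pos_INR N).
  set (t := eps / (INR N + 1)).
  assert (Ht : 0 < t) by (apply Rdiv_lt_0_compat; lra).
  assert (HNt : INR N * t <= eps).
  { replace eps with ((INR N + 1) * t) by (unfold t; field; lra).
    apply Rmult_le_compat_r; lra. }
  (* [m] coordinates above [t] would break the uniform tail bound, so fewer than [m] are large. *)
  destruct (psum_const_unbounded nat w N t eps Hw Ht) as [m Hm].
  set (wm := w (N + m)%nat).
  assert (Hwm : 0 < wm) by now apply weight_pos.
  (* The large coordinates will have moduli summing to at most [eps / wm], and [eta] times this is
     [dl / 4]. *)
  set (eta := dl / 4 * wm / eps).
  assert (Heta : 0 < eta).
  { apply Rdiv_lt_0_compat; [|assumption]. apply Rmult_lt_0_compat; lra. }
  destruct (proj1 (lim0_iff _) Hb eta Heta) as [k0 Hk0].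
  destruct (weakly_null_lsum w xs (seq 0 k0) eps Hw Hx He) as [n1 Hn1].
  exists (n0 + n1)%nat. intros n Hn.
  set (x := xs n).
  assert (Hxd : in_d w x) by apply Hd.
  assert (HNx : forall p, NoDup p -> wsum w N x p <= eps) by (intros; apply HN; [lia | assumption]).
  destruct (proj1 (lim0_iff x) (proj1 Hxd) t Ht) as [N1 HN1].
  set (l := filter (fun k => if Rlt_dec t (Rabs (x k)) then true else false) (seq 0 N1)).
  assert (Hl : NoDup l) by (apply NoDup_filter, seq_NoDup).
  assert (Hin : forall k, In k l <-> t < Rabs (x k)).
  { intros k. unfold l. rewrite filter_In, in_seq.
    destruct (Rlt_dec t (Rabs (x k))) as [H|H]; split; try tauto; try (intros [_ E]; discriminate).
    intros _. split; [|reflexivity]. split; [lia|].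
    apply Nat.nle_gt; intros Hc; apply HN1 in Hc; lra. }
  assert (Hlen : (length l < m)%nat).
  { apply Nat.nle_gt; intros Hc.
    assert (Hf : eps < psum w N (fun _ => t) (firstn m l))
      by (apply Hm; rewrite length_firstn; lia).
    assert (NoDup (firstn m l)).
    { rewrite <- (firstn_skipn m l) in Hl. now apply NoDup_app_remove_r in Hl. }
    assert (psum w N (fun _ => t) (firstn m l) <= wsum w N x (firstn m l)).
    { apply psum_le; [now apply weight_nonneg|]. intros k Hk.
      assert (In k l) by (rewrite <- (firstn_skipn m l); apply in_or_app; now left).
      apply Hin in H0; lra. }
    specialize (HNx _ H). lra. }
  set (u := restrict x l). set (v := vsub x u).
  assert (Hu : in_d w u) by now apply in_d_restrict.
  assert (Hv : forall k, Rabs (v k) <= t /\ Rabs (v k) <= Rabs (x k)).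
  { intros k. unfold v, vsub, u. rewrite restrict_at by assumption.
    destruct (in_dec Nat.eq_dec k l) as [Hk|Hk].
    - replace (x k - x k) with 0 by ring. rewrite Rabs_R0. split; [lra | apply Rabs_pos].
    - rewrite Rminus_0_r. split; [|lra]. rewrite Hin in Hk. lra. }
  assert (Hvd : in_d w v /\ dnorm w v <= 2 * eps).
  { apply in_d_of_bound; [assumption|]. intros p Hp.
    assert (Hs := psum_split_small nat w 0 N (fun k => Rabs (v k)) t p Hw (Rlt_le _ _ Ht)
      (fun k _ => conj (Rabs_pos _) (proj1 (Hv k)))).
    assert (psum w (0 + N) (fun k => Rabs (v k)) (skipn N p) <= wsum w N x (skipn N p)).
    { apply psum_le; [now apply weight_nonneg|]. intros k _; apply Hv. }
    assert (H1 := HNx (skipn N p) (NoDup_skipn _ N p Hp)).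
    unfold wsum at 1. lra. }
  assert (Ex : x = vadd u v)
    by (apply functional_extensionality; intros k; unfold vadd, v, vsub; ring).
  assert (HTu : dnorm w (T u) <= dl / 2).
  { eapply Rle_trans; [now apply op_restrict_norm|].
    rewrite (lsum_filter _ (fun k => Nat.ltb k k0)).
    assert (HTn : forall k, 0 <= dnorm w (T (unit_vec k)) <= C).
    { intros k. destruct (in_d_unit_vec w k Hw) as [H1 H2]. split.
      - apply dnorm_nonneg; [assumption|]. now apply (proj1 HT).
      - eapply Rle_trans; [now apply HTC|]. rewrite <- (Rmult_1_r C) at 2.
        apply Rmult_le_compat_l; assumption. }
    (* Below [k0] the coordinates of [x] are small and the images of unit vectors only bounded; from
       [k0] on the images are small and the coordinates only summable with a uniform bound. *)
    apply Rle_trans with (C * eps + eta * (eps / wm)).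
    - apply Rplus_le_compat.
      + apply Rle_trans with (C * lsum (fun k => Rabs (x k)) (seq 0 k0)).
        * rewrite <- lsum_scal.
          apply Rle_trans with (lsum (fun k => C * Rabs (x k)) (filter (fun k => Nat.ltb k k0) l)).
          -- apply lsum_le. intros k _. rewrite Rmult_comm.
             apply Rmult_le_compat_r; [apply Rabs_pos | apply HTn].
          -- apply lsum_incl.
             ++ intros k; apply Rmult_le_pos; [assumption | apply Rabs_pos].
             ++ now apply NoDup_filter.
             ++ intros k Hk. apply filter_In in Hk as [_ Hk]. apply Nat.ltb_lt in Hk.
                apply in_seq; lia.
        * apply Rmult_le_compat_l; [assumption|]. apply Hn1; lia.
      + apply Rle_trans with (eta * lsum (fun k => Rabs (x k)) l).
        * rewrite <- lsum_scal.
          apply Rle_trans with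
            (lsum (fun k => eta * Rabs (x k)) (filter (fun k => negb (Nat.ltb k k0)) l)).
          -- apply lsum_le. intros k Hk. rewrite Rmult_comm.
             apply Rmult_le_compat_r; [apply Rabs_pos|].
             apply filter_In in Hk as [_ Hk].
             apply Bool.negb_true_iff, Nat.ltb_ge in Hk. specialize (Hk0 k Hk); simpl in Hk0.
             assert (H0 := Rle_abs (dnorm w (T (unit_vec k)))). lra.
          -- apply lsum_incl.
             ++ intros k; apply Rmult_le_pos; [lra | apply Rabs_pos].
             ++ now apply NoDup_filter.
             ++ intros k Hk. now apply filter_In in Hk.
        * apply Rmult_le_compat_l; [lra|].
          apply (Rmult_le_reg_l wm); [assumption|].
          replace (wm * (eps / wm)) with eps by (field; lra).
          eapply Rle_trans; [|exact (HNx l Hl)].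
          apply psum_ge_lsum; [assumption | intros; apply Rabs_pos | lia].
    - replace (eta * (eps / wm)) with (dl / 4) by (unfold eta; field; lra). lra. }
  assert (HTv : dnorm w (T v) <= dl / 4).
  { destruct Hvd as [H1 H2]. eapply Rle_trans; [now apply HTC|].
    eapply Rle_trans; [apply Rmult_le_compat_l; [assumption | exact H2] | assumption]. }
  destruct HT as (HT0 & HT1 & _).
  rewrite Rabs_pos_eq by (apply dnorm_nonneg; auto).
  fold x. rewrite Ex, HT1 by tauto.
  destruct (in_d_vadd w (T u) (T v) Hw) as [_ H]; [apply HT0; tauto..|]. lra.
Qed.

(** * Copies of the space on subsequences, and almost diagonal operators *)

Definition spread (nn : nat -> nat) (a : nat -> R) : nat -> R := fun j =>
  match excluded_middle_informative (exists k, nn k = j) with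
  | left H => a (proj1_sig (constructive_indefinite_description _ H))
  | right _ => 0
  end.

Lemma spread_at nn a k : (forall i j, nn i = nn j -> i = j) -> spread nn a (nn k) = a k.
Proof.
  intros Hi. unfold spread. destruct (excluded_middle_informative _) as [H|H].
  - destruct (constructive_indefinite_description _ H) as [i E]; simpl. now rewrite (Hi i k).
  - destruct H; now exists k.
Qed.

Lemma spread_out nn a j : (forall k, nn k <> j) -> spread nn a j = 0.
Proof.
  intros Hj. unfold spread. destruct (excluded_middle_informative _) as [[k E]|_]; [|reflexivity].
  now destruct (Hj k).
Qed.

Lemma eq_spread nn a z : (forall i j, nn i = nn j -> i = j) ->
  (forall k, z (nn k) = a k) -> (forall j, (forall k, nn k <> j) -> z j = 0) ->
  spread nn a = z.
Proof.
  intros Hi Ha H0. apply functional_extensionality; intros j.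
  destruct (classic (exists k, nn k = j)) as [[k <-]|H].
  - now rewrite spread_at, Ha.
  - assert (Hj : forall k, nn k <> j) by (intros k E; apply H; now exists k).
    now rewrite spread_out, H0.
Qed.

(** [nn] maps injective lists to injective lists. With the opposite bound in [in_d_spread] this
    makes [spread nn] an isometry. *)
Lemma in_d_subsequence w nn z : weight w -> (forall i j, nn i = nn j -> i = j) ->
  in_d w z -> in_d w (fun k => z (nn k)) /\ dnorm w (fun k => z (nn k)) <= dnorm w z.
Proof.
  intros Hw Hi Hz. apply in_d_of_bound; [assumption|]. intros p Hp.
  unfold wsum. rewrite <- (psum_map _ _ w 0 nn (fun j => Rabs (z j))).
  apply wsum_le_dnorm; [assumption..|].
  apply Injective_map_NoDup; [exact Hi | assumption].
Qed.

(** Indices outside the range of [nn] contribute 0, and deleting them only raises the weights of the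
    others; what remains is the image of an injective list. *)
Lemma in_d_spread w nn a : weight w -> (forall i j, nn i = nn j -> i = j) ->
  in_d w a -> in_d w (spread nn a) /\ dnorm w (spread nn a) <= dnorm w a.
Proof.
  intros Hw Hi Ha. apply in_d_of_bound; [assumption|]. intros p Hp.
  set (P := fun j => if excluded_middle_informative (exists k, nn k = j) then true else false).
  assert (Hf := psum_filter w 0 (fun k => Rabs (spread nn a k)) P p Hw (fun k => Rabs_pos _)).
  assert (Hz : lsum (fun k => Rabs (spread nn a k)) (filter (fun a => negb (P a)) p) <= 0).
  { unfold lsum. rewrite (psum_ext _ _ _ _ (fun _ => 0)).
    - rewrite psum_zero; lra.
    - intros j Hj. apply filter_In in Hj as [_ Hj]. unfold P in Hj.
      destruct (excluded_middle_informative (exists k, nn k = j)) as [H|H]; [discriminate|].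
      rewrite spread_out; [apply Rabs_R0|]. intros k E; apply H; now exists k. }
  assert (Hq : exists q, map nn q = filter P p).
  { assert (HP : forall j, In j (filter P p) -> exists k, nn k = j).
    { intros j Hj. apply filter_In in Hj as [_ Hj]. unfold P in Hj.
      destruct (excluded_middle_informative (exists k, nn k = j)); [assumption | discriminate]. }
    clear Hf. induction (filter P p) as [|j l IH]; [now exists nil|].
    destruct (HP j (or_introl eq_refl)) as [k <-].
    destruct IH as [q <-].
    - intros j Hj; apply HP; now right.
    - now exists (k :: q). }
  destruct Hq as [q Eq]. rewrite <- Eq, psum_map in Hf.
  assert (Hqn : NoDup q) by (apply (NoDup_map_inv nn); rewrite Eq; now apply NoDup_filter).
  assert (E : psum w 0 (fun k => Rabs (spread nn a (nn k))) q = wsum w 0 a q)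
    by (apply psum_ext; intros k _; now rewrite spread_at).
  assert (H := wsum_le_dnorm w a q Hw Ha Hqn). unfold wsum in *. lra.
Qed.

Lemma eventually_list (A : Type) (Q : A -> nat -> Prop) h :
  (forall a, In a h -> exists N, forall n, (N <= n)%nat -> Q a n) ->
  exists N, forall n a, (N <= n)%nat -> In a h -> Q a n.
Proof.
  induction h as [|b h IH]; intros H; [exists O; simpl; tauto|].
  destruct IH as [N HN]; [intros a Ha; apply H; now right|].
  destruct (H b (or_introl eq_refl)) as [M HM].
  exists (N + M)%nat. intros n a Hn [<-|Ha]; [apply HM | apply HN]; auto; lia.
Qed.

Lemma lsum_half_le l : NoDup l -> lsum (fun k => (1 / 2) ^ k) l <= 2.
Proof.
  intros Hl. destruct (exists_not_in l) as [M HM].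
  assert (Hp : forall k, 0 <= (1 / 2) ^ k) by (intros; apply pow_le; lra).
  apply Rle_trans with (lsum (fun k => (1 / 2) ^ k) (seq 0 M)).
  - apply lsum_incl; [assumption..|]. intros k Hk. apply HM in Hk. apply in_seq; lia.
  - assert (E : lsum (fun k => (1 / 2) ^ k) (seq 0 M) = 2 - 2 * (1 / 2) ^ M).
    { clear HM. induction M as [|M IH]; [unfold lsum; simpl; lra|].
      rewrite seq_S, lsum_app, lsum_cons, IH. unfold lsum; simpl; lra. }
    rewrite E. specialize (Hp M). lra.
Qed.

Lemma strictly_increasing_injective (f : nat -> nat) :
  (forall i j, (i < j)%nat -> (f i < f j)%nat) -> forall i j, f i = f j -> i = j.
Proof.
  intros H i j E. destruct (Nat.lt_trichotomy i j) as [Hl|[->|Hl]]; [|reflexivity|];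
    apply H in Hl; lia.
Qed.

Lemma strictly_increasing_ge (f : nat -> nat) :
  (forall i j, (i < j)%nat -> (f i < f j)%nat) -> forall k, (k <= f k)%nat.
Proof.
  intros H k; induction k as [|k IH]; [lia|]. specialize (H k (S k) ltac:(lia)). lia.
Qed.

(** Coordinates are bounded by the norm, so vanishing off [S] survives norm limits. *)
Lemma closed_subspace_supported w (S : nat -> Prop) : weight w ->
  closed_subspace w (fun z => in_d w z /\ forall j, ~ S j -> z j = 0).
Proof.
  intros Hw. split; [|split; [|split; [|split]]].
  - intros z Hz; apply Hz.
  - split; [now apply in_d_vzero | reflexivity].
  - intros x y [Hx Hx0] [Hy Hy0]. split; [now apply in_d_vadd|].
    intros j Hj. unfold vadd. rewrite Hx0, Hy0 by assumption; ring.
  - intros a x [Hx Hx0]. split; [now apply in_d_vscal|].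
    intros j Hj. unfold vscal. rewrite Hx0 by assumption; ring.
  - intros zs x Hzs Hx Hlim. split; [assumption|].
    intros j Hj. destruct (Req_dec (x j) 0) as [E|Hne]; [assumption|exfalso].
    assert (Hp : 0 < Rabs (x j)) by now apply Rabs_pos_lt.
    destruct (proj1 (lim0_iff _) Hlim (Rabs (x j) / 2)) as [N HN]; [lra|].
    specialize (HN N (Nat.le_refl _)). simpl in HN.
    assert (Hz := coord_le_dnorm w (vsub (zs N) x) j Hw
      (in_d_vsub w _ _ Hw (proj1 (Hzs N)) Hx)).
    assert (Ha := Rle_abs (dnorm w (vsub (zs N) x))).
    unfold vsub at 1 in Hz. rewrite (proj2 (Hzs N) j Hj) in Hz.
    rewrite Rminus_0_l, Rabs_Ropp in Hz. lra.
Qed.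

Lemma iso_to_d_supported w (nn : nat -> nat) : weight w -> (forall i j, nn i = nn j -> i = j) ->
  iso_to_d w (fun z => in_d w z /\ forall j, ~ (exists k, nn k = j) -> z j = 0).
Proof.
  intros Hw Hi.
  assert (E : forall z, (forall j, ~ (exists k, nn k = j) -> z j = 0) ->
    spread nn (fun k => z (nn k)) = z).
  { intros z Hz. apply eq_spread; auto. intros j Hj. apply Hz. intros [k Ek]; now apply (Hj k). }
  assert (Hout : forall a j, ~ (exists k, nn k = j) -> spread nn a j = 0).
  { intros a j Hj. apply spread_out. intros k Ek; apply Hj; now exists k. }
  exists (spread nn), 1, 1. split; [lra|]. split; [|split; [|split; [|split]]].
  - intros a Ha. split; [now apply in_d_spread | apply Hout].
  - intros z [Hz Hz0]. exists (fun k => z (nn k)). split; [now apply in_d_subsequence | now apply E].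
  - intros x y _ _. apply eq_spread; [assumption| |]; unfold vadd.
    + intros k. now rewrite !spread_at.
    + intros j Hj. rewrite !spread_out by assumption; ring.
  - intros a x _. apply eq_spread; [assumption| |]; unfold vscal.
    + intros k. now rewrite !spread_at.
    + intros j Hj. rewrite !spread_out by assumption; ring.
  - intros x Hx. destruct (in_d_spread w nn x Hw Hi Hx) as [H1 H3].
    destruct (in_d_subsequence w nn (spread nn x) Hw Hi H1) as [_ H2].
    replace (fun k => spread nn x (nn k)) with x in H2; [lra|].
    apply functional_extensionality; intros k. now rewrite spread_at.
Qed.

(* The matrix [T (unit_vec (nn l)) (jj k)] has diagonal at least [eta] and small
   off-diagonal entries, so reading the coordinates [jj] bounds [T] from below on
   the span of the [unit_vec (nn l)]. *)
Lemma almost_diagonal_iso w T nn jj eta : weight w -> bounded_op w T -> 0 < eta ->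
  (forall i j, (i < j)%nat -> (nn i < nn j)%nat) ->
  (forall i j, (i < j)%nat -> (jj i < jj j)%nat) ->
  (forall k, eta < Rabs (T (unit_vec (nn k)) (jj k))) ->
  (forall k l, k <> l ->
     Rabs (T (unit_vec (nn l)) (jj k)) <= eta / 8 * ((1 / 2) ^ k * (1 / 2) ^ l)) ->
  iso_on w T (fun z => in_d w z /\ forall j, ~ (exists k, nn k = j) -> z j = 0).
Proof.
  intros Hw HT He Hnn Hjj Hdiag Hoff.
  assert (Hni := strictly_increasing_injective nn Hnn).
  assert (Hji := strictly_increasing_injective jj Hjj).
  assert (Hnge := strictly_increasing_ge nn Hnn).
  assert (Hhp : forall k, 0 <= (1 / 2) ^ k) by (intros; apply pow_le; lra).
  destruct (bounded_op_bound w T Hw HT) as (C & HC & HTC).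
  exists (eta / 2). split; [lra|]. intros z [Hz Hz0].
  set (a := fun k => z (nn k)). set (D := dnorm w z).
  assert (HD : 0 <= D) by now apply dnorm_nonneg.
  assert (Had := proj1 (in_d_subsequence w nn z Hw Hni Hz)). fold a in Had.
  assert (HDa : D <= dnorm w a).
  { unfold D. replace z with (spread nn a); [now apply in_d_spread|].
    apply eq_spread; auto. intros j Hj. apply Hz0. intros [k Ek]; now apply (Hj k). }
  assert (Haj : forall k, Rabs (a k) <= D) by (intros k; exact (coord_le_dnorm w z (nn k) Hw Hz)).
  assert (HTz : in_d w (T z)) by now apply (proj1 HT).
  assert (Hk : forall k, Rabs (T z (jj k) - a k * T (unit_vec (nn k)) (jj k))
                         <= eta / 4 * D * (1 / 2) ^ k).
  { intros k. apply le_epsilon. intros e Hep.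
    destruct (wsum_tail w z (e / (C + 1)) Hw Hz) as [m Hm]; [apply Rdiv_lt_0_compat; lra|].
    (* Since [nn i >= i], every support index below [m] is in [l]; the summand [S k] brings in the
       diagonal index [k]. *)
    set (l := map nn (seq 0 (m + S k))).
    assert (Hl : NoDup l) by (apply Injective_map_NoDup; [exact Hni | apply seq_NoDup]).
    set (u := restrict z l). set (v := vsub z u).
    assert (Hu : in_d w u) by now apply in_d_restrict.
    assert (Hv : forall j, Rabs (v j) <= Rabs (z j) /\ ((j < m)%nat -> v j = 0)).
    { intros j. unfold v, vsub, u. rewrite restrict_at by assumption.
      destruct (in_dec Nat.eq_dec j l) as [Hj|Hj].
      - replace (z j - z j) with 0 by ring. rewrite Rabs_R0. split; [apply Rabs_pos | auto].
      - rewrite Rminus_0_r. split; [lra|]. intros Hjm. apply Hz0. intros [i <-].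
        apply Hj. apply in_map, in_seq. specialize (Hnge i). lia. }
    assert (Hvd : in_d w v /\ dnorm w v <= e / (C + 1)).
    { apply in_d_of_bound; [assumption|]. intros p Hp.
      assert (Hf := psum_filter w 0 (fun k => Rabs (v k)) (fun j => Nat.leb m j) p Hw
        (fun k => Rabs_pos _)).
      assert (H0 : lsum (fun k => Rabs (v k)) (filter (fun j => negb (Nat.leb m j)) p) <= 0).
      { unfold lsum. rewrite (psum_ext _ _ _ _ (fun _ => 0)).
        - rewrite psum_zero; lra.
        - intros j Hj. apply filter_In in Hj as [_ Hj].
          apply Bool.negb_true_iff, Nat.leb_gt in Hj.
          rewrite (proj2 (Hv j) Hj). apply Rabs_R0. }
      assert (H1 : psum w 0 (fun k => Rabs (v k)) (filter (fun j => Nat.leb m j) p) <=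
                wsum w 0 z (filter (fun j => Nat.leb m j) p)).
      { apply psum_le; [now apply weight_nonneg|]. intros j _; apply Hv. }
      assert (H2 := Hm (filter (fun j => Nat.leb m j) p) (NoDup_filter _ Hp)).
      unfold wsum at 1. enough (wsum w 0 z (filter (fun j => Nat.leb m j) p) <= e / (C + 1)) by lra.
      apply H2. intros q Hq. apply filter_In in Hq as [_ Hq]. now apply Nat.leb_le in Hq. }
    destruct Hvd as [Hvd Hvn].
    assert (Ez : z = vadd u v)
      by (apply functional_extensionality; intros j; unfold vadd, v, vsub; ring).
    assert (ETz : T z (jj k) = T u (jj k) + T v (jj k)).
    { rewrite Ez at 1. rewrite (proj1 (proj2 HT)) by assumption. reflexivity. }
    assert (HTv : Rabs (T v (jj k)) <= e).
    { eapply Rle_trans; [apply coord_le_dnorm; [eassumption | now apply (proj1 HT)]|].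
      eapply Rle_trans; [now apply HTC|].
      apply Rle_trans with (C * (e / (C + 1))); [now apply Rmult_le_compat_l|].
      replace e with ((C + 1) * (e / (C + 1))) at 2 by (field; lra).
      apply Rmult_le_compat_r; [|lra]. apply Rlt_le, Rdiv_lt_0_compat; lra. }
    set (A := fun i => T (unit_vec (nn i)) (jj k)).
    assert (ETu : T u (jj k) = lsum (fun i => a i * A i) (seq 0 (m + S k))).
    { unfold u. rewrite (functional_restrict w (fun x => T x (jj k))); [|assumption|].
      - unfold l, lsum. now rewrite psum_map.
      - apply (bounded_functional_comp w (fun x => x (jj k))); try assumption.
        now apply bounded_functional_coord. }
    assert (Hin : In k (seq 0 (m + S k))) by (apply in_seq; lia).
    assert (Hnd := seq_NoDup (m + S k) 0).
    destruct (in_split _ _ Hin) as (l1 & l2 & El). rewrite El in ETu, Hnd.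
    rewrite lsum_app, lsum_cons in ETu.
    (* Summing [(1 / 2) ^ i] gives at most 2, which turns [eta / 8] into [eta / 4]. *)
    assert (Hrest : Rabs (lsum (fun i => a i * A i) (l1 ++ l2)) <= eta / 4 * D * (1 / 2) ^ k).
    { eapply Rle_trans; [apply psum_abs; intros; lra|].
      apply Rle_trans with (lsum (fun i => D * (eta / 8 * (1 / 2) ^ k) * (1 / 2) ^ i) (l1 ++ l2)).
      - apply lsum_le. intros i Hi'. rewrite Rabs_mult.
        assert (Hki : k <> i) by (intros <-; now apply NoDup_remove_2 in Hnd).
        specialize (Hoff k i Hki). fold (A i) in Hoff.
        replace (D * (eta / 8 * (1 / 2) ^ k) * (1 / 2) ^ i)
          with (D * (eta / 8 * ((1 / 2) ^ k * (1 / 2) ^ i))) by ring.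
        apply Rmult_le_compat; auto; apply Rabs_pos.
      - rewrite lsum_scal.
        assert (H2 := lsum_half_le (l1 ++ l2) (NoDup_remove_1 _ _ _ Hnd)).
        replace (eta / 4 * D * (1 / 2) ^ k) with (D * (eta / 8 * (1 / 2) ^ k) * 2) by field.
        apply Rmult_le_compat_l; [|assumption].
        repeat apply Rmult_le_pos; auto; lra. }
    rewrite lsum_app in Hrest.
    fold (A k). rewrite ETz, ETu.
    replace (lsum (fun i => a i * A i) l1 + (a k * A k + lsum (fun i => a i * A i) l2)
      + T v (jj k) - a k * A k)
      with ((lsum (fun i => a i * A i) l1 + lsum (fun i => a i * A i) l2) + T v (jj k)) by ring.
    eapply Rle_trans; [apply Rabs_triang|]. lra. }
  (* Summing the errors over [k] doubles [eta / 4 * D], so half of [eta * D] remains for the lower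
     bound. *)
  assert (Hfin : dnorm w a <= (dnorm w (T z) + eta / 2 * D) / eta).
  { apply in_d_of_bound; [assumption|]. intros p Hp.
    apply (Rmult_le_reg_l eta); [assumption|].
    replace (eta * ((dnorm w (T z) + eta / 2 * D) / eta))
      with (dnorm w (T z) + eta / 4 * D * 2) by (field; lra).
    unfold wsum. rewrite <- psum_scal.
    apply Rle_trans with
      (psum w 0 (fun k => Rabs (T z (jj k)) + eta / 4 * D * (1 / 2) ^ k) p).
    - apply psum_le; [now apply weight_nonneg|]. intros k _.
      specialize (Hk k). specialize (Hdiag k).
      assert (H1 : eta * Rabs (a k) <= Rabs (a k * T (unit_vec (nn k)) (jj k))).
      { rewrite Rabs_mult, Rmult_comm. apply Rmult_le_compat_l; [apply Rabs_pos | lra]. }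
      assert (H2 := Rabs_triang_inv (a k * T (unit_vec (nn k)) (jj k)) (T z (jj k))).
      rewrite Rabs_minus_sym in H2. lra.
    - rewrite psum_plus. apply Rplus_le_compat.
      + destruct (in_d_subsequence w jj (T z) Hw Hji HTz) as [H1 H2].
        eapply Rle_trans; [|exact H2].
        exact (wsum_le_dnorm w (fun k => T z (jj k)) p Hw H1 Hp).
      + eapply Rle_trans; [apply psum_le_lsum; [assumption|]|].
        * intros k. repeat apply Rmult_le_pos; auto; lra.
        * rewrite lsum_scal. apply Rmult_le_compat_l; [|now apply lsum_half_le].
          apply Rmult_le_pos; lra. }
  fold D.
  apply (Rmult_le_compat_l eta) in Hfin; [|lra].
  replace (eta * ((dnorm w (T z) + eta / 2 * D) / eta))
    with (dnorm w (T z) + eta / 2 * D) in Hfin by (field; lra).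
  assert (eta * D <= eta * dnorm w a) by (apply Rmult_le_compat_l; lra). lra.
Qed.

(** * Extraction of an almost diagonal matrix, and the equivalence *)

Lemma pow_le_1 x n : 0 <= x <= 1 -> x ^ n <= 1.
Proof. intros H. rewrite <- (pow1 n). now apply pow_incr. Qed.

(** Off-diagonal entries are small for two reasons: a fixed image vector has coordinates tending to
    0, and a fixed coordinate of [T (unit_vec n)] tends to 0 in [n] by weak nullity. *)
Lemma basis_image_null w T : weight w -> bounded_op w T -> d_strictly_singular w T ->
  is_lim_seq (fun k => dnorm w (T (unit_vec k))) 0.
Proof.
  intros Hw HT HSS. apply NNPP; intros Hn.
  destruct (not_lim0_frequently _ Hn) as (dl & Hdl & Hfr).
  set (y := fun n => T (unit_vec n)).
  assert (Hy : forall n, in_d w (y n)) by (intros n; apply (proj1 HT); now apply in_d_unit_vec).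
  assert (Hyw : weakly_null w y)
    by (apply weakly_null_image; try assumption; now apply unit_vec_weakly_null).
  destruct (weakly_null_uniform_tail w y (dl / 4) Hw Hy Hyw) as (N & n0 & HN); [lra|].
  assert (HNp := pos_INR N).
  (* If all coordinates were at most [eta], the norm would be at most
     [N * eta + dl / 4 <= dl / 2]. *)
  set (eta := dl / 4 / (INR N + 1)).
  assert (He : 0 < eta) by (apply Rdiv_lt_0_compat; lra).
  assert (HNe : INR N * eta <= dl / 4).
  { replace (dl / 4) with ((INR N + 1) * eta) by (unfold eta; field; lra).
    apply Rmult_le_compat_r; lra. }
  assert (Hbig : forall M, exists n j, (M <= n)%nat /\ eta < Rabs (y n j)).
  { intros M. destruct (Hfr (M + n0)%nat) as (n & Hnn & Hlt).
    rewrite Rabs_pos_eq in Hlt by (apply dnorm_nonneg; [assumption | apply Hy]).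
    apply NNPP; intros Hc.
    assert (Hb : dnorm w (y n) <= dl / 2).
    { apply in_d_of_bound; [assumption|]. intros p Hp.
      assert (Hs := psum_split_small nat w 0 N (fun k => Rabs (y n k)) eta p Hw (Rlt_le _ _ He)).
      assert (H1 := HN n (skipn N p) ltac:(lia) (NoDup_skipn _ N p Hp)).
      unfold wsum in *. rewrite Nat.add_0_l in Hs.
      enough (psum w 0 (fun k => Rabs (y n k)) p <=
        INR N * eta + psum w N (fun k => Rabs (y n k)) (skipn N p)) by lra.
      apply Hs. intros j _. split; [apply Rabs_pos|]. apply Rnot_lt_le; intros Hl.
      apply Hc. exists n, j. split; [lia | assumption]. }
    unfold y in *. lra. }
  (* Decay 1/4 in the later of two positions yields decay 1/2 in each of them. *)
  destruct (history_choice (nat * nat) (fun h a =>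
    eta < Rabs (y (fst a) (snd a)) /\
    forall b, In b h -> (fst b < fst a)%nat /\ (snd b < snd a)%nat /\
      Rabs (y (fst a) (snd b)) <= eta / 8 * (1 / 4) ^ length h /\
      Rabs (y (fst b) (snd a)) <= eta / 8 * (1 / 4) ^ length h)) as [s Hs].
  { intros h. set (r := eta / 8 * (1 / 4) ^ length h).
    assert (Hr : 0 < r) by (apply Rmult_lt_0_compat; [lra | apply pow_lt; lra]).
    assert (Hre : r < eta).
    { assert ((1 / 4) ^ length h <= 1) by (apply pow_le_1; lra).
      assert (r <= eta / 8 * 1) by (apply Rmult_le_compat_l; lra). lra. }
    destruct (eventually_list _ (fun (b : nat * nat) j =>
      (snd b < j)%nat /\ Rabs (y (fst b) j) <= r) h) as [J HJ].
    { intros b _. destruct (proj1 (lim0_iff _) (proj1 (Hy (fst b))) r Hr) as [J HJ].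
      exists (J + S (snd b))%nat. intros j Hj. split; [lia|]. apply HJ; lia. }
    destruct (exists_not_in (map fst h)) as [M HM].
    destruct (weakly_null_lsum w y (seq 0 J) r Hw Hyw Hr) as [n1 Hn1].
    destruct (Hbig (M + n1)%nat) as (n & j & Hnn & Hlt).
    specialize (Hn1 n ltac:(lia)).
    assert (Hsm : forall i, (i < J)%nat -> Rabs (y n i) <= r).
    { intros i Hi. eapply Rle_trans; [|exact Hn1].
      apply Rle_trans with (lsum (fun k => Rabs (y n k)) (i :: nil)).
      - rewrite lsum_cons. unfold lsum; simpl; lra.
      - apply lsum_incl; [intros; apply Rabs_pos | repeat constructor; simpl; tauto|].
        intros k [<-|[]]. apply in_seq; lia. }
    (* Below [J] the new vector is at most [r < eta], so its large coordinate lies where the earlier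
       vectors are already small. *)
    assert (HjJ : (J <= j)%nat).
    { apply Nat.nlt_ge; intros Hc. apply Hsm in Hc. lra. }
    exists (n, j); simpl. split; [assumption|]. intros b Hb.
    destruct (HJ j b HjJ Hb) as [H1 H2].
    destruct (HJ J b (Nat.le_refl _) Hb) as [H3 _].
    split; [|split; [|split]]; [ | assumption | now apply Hsm | assumption].
    assert (fst b < M)%nat by (apply HM, in_map; assumption). lia. }
  set (nn := fun k => fst (s k)). set (jj := fun k => snd (s k)).
  assert (Hlk : forall l k, (l < k)%nat -> (nn l < nn k)%nat /\ (jj l < jj k)%nat /\
      Rabs (y (nn k) (jj l)) <= eta / 8 * (1 / 4) ^ k /\
      Rabs (y (nn l) (jj k)) <= eta / 8 * (1 / 4) ^ k).
  { intros l k Hl. destruct (Hs k) as [_ H]. rewrite length_map, length_seq in H.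
    apply (H (s l)). apply in_map, in_seq; lia. }
  assert (Hpow : forall l k, (l <= k)%nat -> (1 / 4) ^ k <= (1 / 2) ^ k * (1 / 2) ^ l).
  { intros l k Hl. replace (1 / 4) with (1 / 2 * (1 / 2)) by field.
    rewrite Rpow_mult_distr. apply Rmult_le_compat_l; [apply pow_le; lra|].
    replace k with (l + (k - l))%nat by lia. rewrite pow_add.
    rewrite <- (Rmult_1_r ((1 / 2) ^ l)) at 2.
    apply Rmult_le_compat_l; [apply pow_le; lra|].
    apply pow_le_1; lra. }
  assert (Hinj := strictly_increasing_injective nn (fun i j Hij => proj1 (Hlk i j Hij))).
  apply (HSS _ (closed_subspace_supported w (fun j => exists k, nn k = j) Hw)
    (iso_to_d_supported w nn Hw Hinj)).
  apply (almost_diagonal_iso w T nn jj eta); try assumption.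
  - intros i j Hij; now apply Hlk.
  - intros i j Hij; now apply Hlk.
  - intros k. apply (Hs k).
  - intros k l Hkl. fold (y (nn l)).
    destruct (Nat.lt_total k l) as [H|[H|H]]; [| contradiction |].
    + destruct (Hlk k l H) as (_ & _ & H1 & _). eapply Rle_trans; [exact H1|].
      apply Rmult_le_compat_l; [lra|]. rewrite (Rmult_comm ((1 / 2) ^ k)). apply Hpow; lia.
    + destruct (Hlk l k H) as (_ & _ & _ & H1). eapply Rle_trans; [exact H1|].
      apply Rmult_le_compat_l; [lra|]. apply Hpow; lia.
Qed.

Theorem theorem5p7 (w : nat -> R) (T : (nat -> R) -> (nat -> R)) :
  weight w -> bounded_op w T ->
  (d_strictly_singular w T <-> dunford_pettis w T).
Proof.
  intros Hw HT; split.
  - intros HSS. apply dunford_pettis_of_basis; try assumption.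
    now apply basis_image_null.
  - now apply dunford_pettis_strictly_singular.
Qed.
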